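(* The decision problem ARRIVAL is in $\mathrm{coNP}$.
   Context: A switch graph is a 4-tuple $G=(V,E,s_0,s_1)$ where $V$ is a finite vertex set, $n=|V|$, $s_0,s_1:V\to V$, and $E=\{(v,s_0(v)):v\in V\}\cup\{(v,s_1(v)):v\in V\}$ (loops allowed; possibly $s_0(v)=s_1(v)$). The procedure $\textsc{Run}(G,o,d)$: maintain arrays $\mathtt{s\_curr},\mathtt{s\_next}$ indexed by $V$, initially $\mathtt{s\_curr}[v]=s_0(v)$, $\mathtt{s\_next}[v]=s_1(v)$; set $v:=o$; while $v\neq d$: $w:=\mathtt{s\_curr}[v]$, swap $\mathtt{s\_curr}[v],\mathtt{s\_next}[v]$, $v:=w$ (traversing edge $(v,w)$). ARRIVAL is the decision problem: given a switch graph $G$ (encoded by the maps $s_0,s_1$) and $o,d\in V$, does $\textsc{Run}(G,o,d)$ terminate? *)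

(* Defs.v *)
From mathcomp Require Import all_boot.
Set Implicit Arguments. Unset Strict Implicit. Unset Printing Implicit Defensive.

(* A switch graph on V = 'I_n is given by the two maps s0 s1. The state *)
(* of Run is (v, s_curr, s_next).                                       *)

Definition run_state (n : nat) : Type :=
  ('I_n * {ffun 'I_n -> 'I_n} * {ffun 'I_n -> 'I_n})%type.

Definition run_init (n : nat) (s0 s1 : 'I_n -> 'I_n) (o : 'I_n) : run_state n :=
  (o, [ffun v => s0 v], [ffun v => s1 v]).

Definition run_step (n : nat) (st : run_state n) : run_state n :=
  let: (v, cur, nxt) := st in
  (cur v,
   [ffun u => if u == v then nxt v else cur u],
   [ffun u => if u == v then cur v else nxt u]).

(* Run(G,o,d) terminates iff the current vertex equals d after some
   number of loop iterations (the loop stops at the first such time). *)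
Definition run_terminates (n : nat) (s0 s1 : 'I_n -> 'I_n) (o d : 'I_n) : Prop :=
  exists k : nat, (iter k (@run_step n) (run_init s0 s1 o)).1.1 = d.

Definition enc_nat (m : nat) : seq bool := nseq m true ++ [:: false].

Definition enc_instance (n : nat) (s0 s1 : 'I_n -> 'I_n) (o d : 'I_n) : seq bool :=
  enc_nat n
  ++ flatten [seq enc_nat (s0 v) ++ enc_nat (s1 v) | v <- enum 'I_n]
  ++ enc_nat o ++ enc_nat d.

Definition arrival_lang (x : seq bool) : Prop :=
  exists (n : nat) (s0 s1 : 'I_n -> 'I_n) (o d : 'I_n),
    x = enc_instance s0 s1 o d /\ run_terminates s0 s1 o d.

Inductive tm_move := MoveL | MoveR | Stay.

Record TM := {
  tm_state : finType;
  tm_sym : finType;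
  tm_blank : tm_sym;
  tm_sym0 : tm_sym;
  tm_sym1 : tm_sym;
  tm_sep : tm_sym;
  tm_start : tm_state;
  tm_accept : tm_state;
  tm_delta : tm_state -> tm_sym -> tm_state * tm_sym * tm_move
}.

(* configuration: state, left part of tape (reversed, nearest cell first),
   scanned symbol, right part of tape; the tape is blank beyond the lists *)
Definition tm_config (M : TM) : Type :=
  (tm_state M * seq (tm_sym M) * tm_sym M * seq (tm_sym M))%type.

Definition tm_step (M : TM) (c : tm_config M) : tm_config M :=
  let: (q, l, h, r) := c in
  let: (q', a, m) := tm_delta q h in
  match m with
  | MoveL => (q', behead l, head (tm_blank M) l, a :: r)
  | MoveR => (q', a :: l, head (tm_blank M) r, behead r)
  | Stay  => (q', l, a, r)
  end.

Definition tm_init (M : TM) (w : seq (tm_sym M)) : tm_config M :=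
  (tm_start M, [::], head (tm_blank M) w, behead w).

Definition tm_bit (M : TM) (b : bool) : tm_sym M :=
  if b then tm_sym1 M else tm_sym0 M.

Definition tm_input2 (M : TM) (x u : seq bool) : seq (tm_sym M) :=
  map (@tm_bit M) x ++ tm_sep M :: map (@tm_bit M) u.

Definition tm_accepts_within (M : TM) (w : seq (tm_sym M)) (t : nat) : Prop :=
  exists i, i <= t /\ (iter i (@tm_step M) (@tm_init M w)).1.1.1 = tm_accept M.

Definition in_NP (L : seq bool -> Prop) : Prop :=
  exists (M : TM) (c k : nat), forall x : seq bool,
    L x <-> exists u : seq bool,
      size u <= c * size x ^ k + c /\
      @tm_accepts_within M (tm_input2 M x u) (c * (size x + size u) ^ k + c).

Definition in_coNP (L : seq bool -> Prop) : Prop :=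
  in_NP (fun x => ~ L x).

(* Main.v *)
(* A run that never reaches d is certified by a set S of vertices that contains both
   successors of its members but not d, and by numbers T v for v outside S such that T v is at
   least [v = o] plus the flow ceil(T u / 2), floor(T u / 2) sent to v along the two arcs of
   every u, and T d = 0: by induction on the run, no vertex v outside S is visited more than
   T v times as long as the run avoids S. Conversely, if d is never reached, take for S the
   vertices from which d is unreachable. A vertex with a path of length k to d is left fewer
   than 2 ^ k times, so the run enters S, and the visit counts at that moment are numbers T v
   with at most n bits.

   T is coded in binary together with the carries of the column sums, as a ternary relation on
   numbers below the length of the input. Validity of this certificate is then a first-order
   formula with counting over the positions of the word x # u. Formulas are compiled to counter
   machines whose counters range over positions, and these to single-tape machines that mark
   the value of each counter on the tape and execute one instruction per sweep. *)
Require Import Defs.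
From mathcomp Require Import all_boot.
From mathcomp Require Import zify.
Set Implicit Arguments. Unset Strict Implicit. Unset Printing Implicit Defensive.

(** * The flow certificate *)

Section Run.
Variables (n : nat) (s0 s1 : 'I_n -> 'I_n) (o d : 'I_n).

Definition run_at k := iter k (@run_step n) (run_init s0 s1 o).
Definition pos k := (run_at k).1.1.
Definition visits k v := \sum_(j < k) (pos j == v).

Lemma visitsS k v : visits k.+1 v = visits k v + (pos k == v).
Proof. by rewrite /visits big_ord_recr. Qed.

(** Every departure from [v] swaps the two entries at [v], so the parity of the visits determines
    them. *)
Lemma run_at_switches k v :
  (run_at k).1.2 v = (if odd (visits k v) then s1 v else s0 v) /\
  (run_at k).2 v = (if odd (visits k v) then s0 v else s1 v).
Proof.
elim: k => [|k IH]; first by rewrite /visits big_ord0 /= !ffunE.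
rewrite visitsS /pos /run_at iterS -/(run_at k).
case: (run_at k) IH => [[p cur] nxt] /= [IH1 IH2].
rewrite !ffunE eq_sym; case: eqP => [->|_] /=; last by rewrite addn0.
by rewrite oddD IH1 IH2; case: odd.
Qed.

Lemma posS k : pos k.+1 = if odd (visits k (pos k)) then s1 (pos k) else s0 (pos k).
Proof.
rewrite -(run_at_switches k (pos k)).1 /pos /run_at iterS -/(run_at k).
by case: (run_at k) => [[p cur] nxt].
Qed.

Definition inflow (T : 'I_n -> nat) w :=
  \sum_u ((s0 u == w) * uphalf (T u) + (s1 u == w) * (T u)./2).

(** Flow conservation: every visit is either the start or the end of a traversed arc. The indices
    differ by one because after [k] steps the vertex [pos k] is visited but not yet left. *)
Lemma visits_inflow k w : visits k.+1 w = (o == w) + inflow (visits k) w.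
Proof.
elim: k => [|k IH].
  rewrite visitsS /visits big_ord0 /inflow big1 ?addn0 // => u _.
  by rewrite big_ord0 !muln0.
rewrite visitsS IH -addnA; congr addn.
(* Only the summand of [pos k] changes; the parity of its visits decides which of the two halves
   grows. *)
rewrite /inflow (bigD1 (pos k)) //= [RHS](bigD1 (pos k)) //=.
rewrite (eq_bigr (fun u => (s0 u == w) * uphalf (visits k.+1 u) + (s1 u == w) * (visits k.+1 u)./2)); last first.
  by move=> u neq; rewrite visitsS (eq_sym (pos k)) (negbTE neq) addn0.
rewrite posS visitsS eqxx addn1 /= uphalf_half addnAC; congr addn.
have := odd_double_half (visits k (pos k)).
by case: odd => /= H; rewrite ?uphalf_half; case: (s0 _ == w); case: (s1 _ == w); lia.
Qed.

Lemma inflow_le T T' w : (forall u, T u <= T' u) -> inflow T w <= inflow T' w.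
Proof. by move=> le; apply: leq_sum => u _; rewrite leq_add // leq_mul // ?uphalf_leq ?half_leq. Qed.

Lemma flow_cert_sound (S : pred 'I_n) (T : 'I_n -> nat) :
  (forall u, S u -> S (s0 u) && S (s1 u)) -> ~~ S d -> T d = 0 ->
  (forall w, ~~ S w -> (o == w) + inflow (fun u => if S u then 0 else T u) w <= T w) ->
  ~ run_terminates s0 s1 o d.
Proof.
move=> Scl Sd Td Tsup [k posk].
have Sn j : S (pos j) -> S (pos j.+1).
  by move=> /Scl/andP[]; rewrite posS; case: odd.
(* [S] cannot be left, and the run is at [d], outside [S], at time [k]. *)
have nS j : j <= k -> ~~ S (pos j).
  move=> jk; apply: contraNN Sd => Sj; rewrite -posk -/(run_at k) -/(pos k) -(subnK jk).
  by elim: (k - j) => // i IH; rewrite addSn; apply: Sn.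
have dom j : j <= k.+1 -> forall w, visits j w <= if S w then 0 else T w.
  elim: j => [|j IH] jk w; first by rewrite /visits big_ord0.
  case: ifPn => Sw.
    move: (IH (ltnW jk) w); rewrite Sw visitsS.
    by case: eqP => [E|_]; [have := nS j jk; rewrite E Sw | rewrite addn0].
  rewrite visits_inflow; apply: leq_trans (Tsup w Sw).
  by rewrite leq_add2l; apply: inflow_le; apply: IH; apply: ltnW.
(* [visits k.+1] includes the visit of [d] at time [k], against [T d = 0]. *)
have := dom _ (leqnn _) d; rewrite (negbTE Sd) Td visitsS.
by rewrite [pos k]posk eqxx addn1.
Qed.

Definition arc := [rel u w | (w == s0 u) || (w == s1 u)].

Lemma flow_cert_complete :
  ~ run_terminates s0 s1 o d ->
  exists (S : pred 'I_n) (T : 'I_n -> nat),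
  [/\ forall u, S u -> S (s0 u) && S (s1 u), ~~ S d, T d = 0,
      forall u, ~~ S u -> T u < 2 ^ n &
      forall w, ~~ S w -> (o == w) + inflow (fun u => if S u then 0 else T u) w = T w].
Proof.
move=> nt.
have posd k : pos k != d by apply/eqP => E; apply: nt; exists k.
pose S := [pred v | ~~ connect arc v d].
have Scl u : S u -> S (s0 u) && S (s1 u).
  move=> /= Su; apply/andP; split; apply: contra Su; apply: connect_trans;
  by apply: connect1; rewrite /= eqxx ?orbT.
have vd k : visits k d = 0.
  by rewrite /visits big1 // => j _; rewrite (negbTE (posd j)).
(* At least half of the departures from [v], rounded down, go to the next vertex of the path, so
   each arc at most doubles the strict bound. *)
have path_bound p : forall v, path arc v p -> last v p = d -> forall k, visits k v < 2 ^ size p.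
  elim: p => [|w p IH] v /=; first by move=> _ -> k; rewrite vd.
  move=> /andP[vw pth] lst k; have := IH w pth lst k.+1.
  rewrite visits_inflow /inflow (bigD1 v) //= expnS mul2n -addnn => H.
  have := odd_double_half (visits k v); rewrite uphalf_half in H.
  case/orP: vw => /eqP E; rewrite -E eqxx /= in H.
    by case: (s1 v == w) H; case: odd; lia.
  by case: (s0 v == w) H; case: odd; lia.
have bound u k : ~~ S u -> visits k u < 2 ^ n.
  (* A path without repetition has fewer than [n] arcs. *)
  move=> /= /negPn/connectP[p0 p0P lst]; case/shortenP: p0P lst => p pP pU _ lst.
  apply: leq_trans (path_bound p u pP (esym lst) k) _; rewrite leq_exp2l //.
  by move: (max_card [in u :: p]); rewrite (card_uniqP pU) card_ord; apply: ltnW.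
(* Pigeonhole: outside [S] the visits sum to less than [n * 2 ^ n + 1], while after that many steps
   they sum to the number of steps. *)
have [K SK] : exists K, S (pos K).
  have [/existsP[K SK]|/existsPn nS] := boolP [exists K : 'I_(n * 2 ^ n).+1, S (pos K)].
    by exists K.
  have tot k : \sum_v visits k v = k.
    elim: k => [|k IH]; first by rewrite big1 // => v _; rewrite /visits big_ord0.
    rewrite (eq_bigr (fun v => visits k v + (pos k == v))); last by move=> v _; rewrite visitsS.
    rewrite big_split /= IH (bigD1 (pos k)) //= eqxx big1 ?addn1 // => v.
    by rewrite eq_sym => /negbTE ->.
  have := tot (n * 2 ^ n).+1; have : \sum_v visits (n * 2 ^ n).+1 v <= \sum_(v < n) 2 ^ n.
    apply: leq_sum => v _; have [Sv|Sv] := boolP (S v); last exact: ltnW (bound _ _ Sv).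
    rewrite /visits big1 // => j _; case: eqP => // E; have := nS j; rewrite E Sv; done.
  by rewrite sum_nat_const card_ord => H E; rewrite E ltnn in H.
exists S, (visits K); split=> // [|u Su|w Sw].
- by rewrite /S /= negbK connect0.
- exact: bound.
(* At time [K] the run is inside [S], so no vertex outside [S] gains a visit; this removes the shift
   of one in [visits_inflow] and yields equality. *)
have <- : visits K.+1 w = visits K w.
  by rewrite visitsS; case: eqP => [E|]; rewrite ?addn0 //; rewrite E (negbTE Sw) in SK.
rewrite visits_inflow; congr addn; apply: eq_bigr => u _.
(* A vertex of [S] sends nothing to [w], since both of its successors lie in [S]. *)
case: ifP => // Su; have /andP[S0 S1] := Scl u Su.
have -> : (s0 u == w) = false by apply/eqP => E; rewrite E (negbTE Sw) in S0.
by have -> : (s1 u == w) = false by apply/eqP => E; rewrite E (negbTE Sw) in S1.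
Qed.

End Run.

(** * Binary certificates *)

(** A carry [k] is coded in unary by the numbers from 1 to [k]; counting recovers it when the range
    is long enough. *)
Lemma count_range N k : k < N -> count (fun c => (0 < c) && (c <= k)) (iota 0 N) = k.
Proof.
move=> kN; have -> : N = 1 + k + (N - k.+1) by lia.
rewrite !iotaD !count_cat /= add0n -(addn0 k); congr addn; last first.
  by rewrite -[RHS](count_pred0 (iota (1 + k) (N - (k + 0).+1))) addn0; apply: eq_in_count => c; rewrite mem_iota /=; lia.
rewrite add0n addn0 -[RHS](size_iota 1 k); apply/eqP; rewrite -all_count.
by apply/allP => c; rewrite mem_iota; lia.
Qed.

Section BinaryCertificate.
Variables (n : nat) (s0 s1 : 'I_n -> 'I_n) (o d : 'I_n).

Section Def.
Variables (N : nat) (R : nat -> nat -> nat -> bool).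

Definition carry_of v b := count (fun c => (0 < c) && R v b c) (iota 0 N).

(* One ternary relation codes the whole certificate: the vertices of row n of the
   relation form S, R v b 0 is bit b of T v, and the number of c > 0 with R v b c
   is the carry into column b when the inflow of v is summed in binary. *)
Record bincert : Prop := {
  bincert_closed : forall u : 'I_n, R n u 0 -> R n (s0 u) 0 && R n (s1 u) 0;
  bincert_target : ~~ R n d 0;
  bincert_zero : forall b, b < N -> ~~ R d b 0;
  bincert_init : forall v : 'I_n, ~~ R n v 0 ->
    carry_of v 0 = (o == v) + \sum_u ((s0 u == v) && R u 0 0);
  bincert_column : forall v : 'I_n, ~~ R n v 0 -> forall b, b < n ->
    carry_of v b + \sum_u ((s0 u == v) && R u b.+1 0) + \sum_u ((s1 u == v) && R u b.+1 0)
      = R v b 0 + (carry_of v b.+1).*2;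
  bincert_top : forall v : 'I_n, ~~ R n v 0 -> carry_of v n = 0
}.

End Def.

(** Halving shifts bits, so column [b] adds up the bits [b.+1] of the senders. The start and the
    bits 0, which account for rounding up along [s0], enter as the carry into column 0. *)
Lemma bincert_sound N R : n < N -> bincert N R -> ~ run_terminates s0 s1 o d.
Proof.
move=> nN [cl nd zd ini col top].
pose H u := \sum_(b < n) R u b.+1 0 * 2 ^ b.
pose T (u : 'I_n) := R u 0 0 + (H u).*2.
have TE u : T u = \sum_(b < n.+1) R u b 0 * 2 ^ b.
  rewrite big_ord_recl /= muln1 /T; congr addn.
  by rewrite /H -muln2 big_distrl /=; apply: eq_bigr => b _; rewrite expnSr mulnA.
apply: (@flow_cert_sound n s0 s1 o d (fun u => R n u 0) T) => // [|w Sw].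
  by rewrite TE big1 // => b _; rewrite (negbTE (zd b _)) // (leq_trans _ nN) // ltnS -ltnS.
(* Weighted by [2 ^ b], the column equations telescope in the carries. *)
have tele j : j <= n -> carry_of N R w 0 +
    \sum_(b < j) (\sum_u ((s0 u == w) && R u b.+1 0) + \sum_u ((s1 u == w) && R u b.+1 0)) * 2 ^ b
    = \sum_(b < j) R w b 0 * 2 ^ b + carry_of N R w j * 2 ^ j.
  elim: j => [|j IH] jn; first by rewrite !big_ord0 muln1 addn0.
  rewrite !big_ord_recr /= addnA IH ?(ltnW jn) // -!addnA; congr addn.
  by rewrite -mulnDl addnA col // mulnDl expnS -mul2n mulnCA mulnA (mulnC 2).
have := tele n (leqnn n); rewrite top // mul0n addn0 ini // => E.
(* [T w] has [n.+1] bits but only [n] columns are constrained; a possible top bit only increases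
   [T w], and an inequality suffices. *)
apply: (@leq_trans (\sum_(b < n) R w b 0 * 2 ^ b)); last first.
  by rewrite TE big_ord_recr leq_addr.
rewrite -E -addnA leq_add2l /inflow.
rewrite [X in _ <= _ + X](eq_bigr (fun b : 'I_n => \sum_u (((s0 u == w) && R u b.+1 0) + ((s1 u == w) && R u b.+1 0)) * 2 ^ b)); last first.
  by move=> b _ /=; rewrite -big_distrl /= big_split.
rewrite exchange_big -big_split /=; apply: leq_sum => u _.
have -> : \sum_(b < n) (((s0 u == w) && R u b.+1 0) + ((s1 u == w) && R u b.+1 0)) * 2 ^ b
          = ((s0 u == w) + (s1 u == w)) * H u.
  by rewrite /H big_distrr /=; apply: eq_bigr => b _; rewrite -!mulnb -mulnDl mulnA.
case: (R n u 0); first by rewrite !muln0.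
have -> : uphalf (T u) = R u 0 0 + H u by rewrite /T uphalf_half oddD odd_double halfD odd_double doubleK; case: (R u 0 0).
have -> : (T u)./2 = H u by rewrite /T halfD odd_double doubleK; case: (R u 0 0).
by case: (s0 u == w); case: (s1 u == w); lia.
Qed.

Lemma mod_expnS x b : x %% 2 ^ b.+1 = odd (x %/ 2 ^ b) * 2 ^ b + x %% 2 ^ b.
Proof.
have p : 0 < 2 ^ b by rewrite expn_gt0.
rewrite {1}(divn_eq x (2 ^ b)) -{1}(odd_double_half (x %/ 2 ^ b)).
rewrite mulnDl -muln2 -mulnA -expnS addnAC addnC modnMDl modn_small //.
have := ltn_pmod x p; rewrite expnS; case: odd => /=; lia.
Qed.

(** The carries are those of schoolbook addition. The bounds on [a], [b], [c] keep the relation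
    small enough to be listed in polynomial length. *)
Lemma bincert_complete : ~ run_terminates s0 s1 o d ->
  exists2 R, forall N, 3 * n + 1 < N -> bincert N R &
    forall a b c, R a b c -> [/\ a <= n, b <= n & c <= 3 * n + 1].
Proof.
move=> /flow_cert_complete[S [T0 [Scl Sd Td0 Tb0 TE0]]].
pose T u := if S u then 0 else T0 u.
have Td : T d = 0 by rewrite /T Td0 if_same.
have Tb u : T u < 2 ^ n by rewrite /T; case: ifPn => [_|/Tb0//]; rewrite expn_gt0.
have {}TE w : ~~ S w -> (o == w) + inflow s0 s1 T w = T w.
  by move=> Sw; rewrite TE0 // /T (negbTE Sw).
(* [I v] is the initial carry, [X v b] adds to it the columns below [b], and [C v b] is what
   overflows into column [b]. *)
pose I v := (o == v) + \sum_u ((s0 u == v) && odd (T u)).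
pose X v b := I v + \sum_u ((s0 u == v) + (s1 u == v)) * ((T u)./2 %% 2 ^ b).
pose C v b := X v b %/ 2 ^ b.
have sum_le (F : 'I_n -> bool) : \sum_u F u <= n.
  by rewrite -[X in _ <= X]card_ord -sum1_card; apply: leq_sum => u _; case: (F u).
have Cb v b : C v b <= 3 * n + 1.
  have p : 0 < 2 ^ b by rewrite expn_gt0.
  rewrite /C -ltnS ltn_divLR // /X /I.
  have : \sum_u ((s0 u == v) + (s1 u == v)) * ((T u)./2 %% 2 ^ b) <= \sum_(u < n) 2 * 2 ^ b.
    apply: leq_sum => u _; apply: leq_mul; first by case: (_ == _); case: (_ == _).
    by apply: ltnW; rewrite ltn_mod.
  rewrite sum_nat_const card_ord; have := sum_le (fun u => (s0 u == v) && odd (T u)).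
  have : (o == v) <= 1 by case: (_ == _).
  move: (nat_of_bool (o == v)) (\sum_u ((s0 u == v) && odd (T u))) (\sum_u (_ + _) * _) => x y z ? ? ?.
  have : (x + y) <= n.+1 * 2 ^ b by apply: leq_trans (leq_pmulr _ p); lia.
  lia.
(* [insub a] succeeds exactly for [a < n]: these rows hold bits at [c = 0] and unary carries at
   [c > 0], while row [n] holds [S]. *)
pose R a b c := if insub a is Some v then
    (b <= n) && (if c == 0 then odd (T v %/ 2 ^ b) else c <= C v b)
  else [&& a == n, c == 0 & if insub b is Some v then S v else false].
have RS (v : 'I_n) : R n v 0 = S v.
  by rewrite /R insubF ?ltnn // !eqxx valK.
have RB (v : 'I_n) b : R v b 0 = odd (T v %/ 2 ^ b).
  rewrite /R valK /=; case: leqP => // nb; rewrite divn_small //.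
  by apply: leq_trans (Tb v) _; rewrite leq_exp2l // ltnW.
exists R; last first.
  move=> a b c; rewrite /R; case: insubP => [v _ <-|].
    case/andP=> bn; case: eqP => [-> _|_ cC]; split=> //; try exact: ltnW (ltn_ord v).
    exact: leq_trans cC (Cb v b).
  by move=> _ /and3P[/eqP -> /eqP ->]; case: insubP => // v /ltnW bn _ _; split=> //.
(* Truncating the halves modulo [2 ^ b] does not affect the total modulo [2 ^ b], and the full total
   is [T v]. *)
have Xmod v b : ~~ S v -> X v b %% 2 ^ b = T v %% 2 ^ b.
  move=> Sv; rewrite -(TE v Sv) /inflow.
  rewrite (eq_bigr (fun u => ((s0 u == v) && odd (T u)) + ((s0 u == v) + (s1 u == v)) * (T u)./2)); last first.
    by move=> u _; rewrite uphalf_half; case: (s0 u == v); case: (s1 u == v); lia.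
  rewrite big_split /= addnA -/(I v) /X -modnDmr -[RHS]modnDmr; congr ((_ + _) %% _).
  apply: (big_ind2 (fun x y => x = y %[mod 2 ^ b])) => // [x1 x2 y1 y2 e1 e2|u _].
    by rewrite -modnDm e1 e2 modnDm.
  by rewrite modnMmr.
move=> N nN; have RC (v : 'I_n) b : b <= n -> carry_of N R v b = C v b.
  move=> bn; rewrite -(@count_range N (C v b)); last exact: leq_ltn_trans (Cb v b) nN.
  by apply: eq_count => c; rewrite /R valK bn /=; case: c.
split=> [u||b bN|v|v|v]; rewrite ?RS //.
- exact: Scl.
- by rewrite RB Td div0n.
- move=> Sv; rewrite RC // /C expn0 divn1 /X big1 => [|u _]; last by rewrite expn0 modn1 muln0.
  rewrite addn0 /I; congr addn; apply: eq_bigr => u _.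
  by rewrite RB expn0 divn1.
- move=> Sv b bn; rewrite RB !RC ?(ltnW bn) //.
  have p : 0 < 2 ^ b by rewrite expn_gt0.
  (* The column equation results from dividing both sides with remainder, by [Xmod], and cancelling
     [T v %% 2 ^ b] and the factor [2 ^ b]. *)
  have XS : X v b.+1 = X v b + (\sum_u ((s0 u == v) && odd (T u %/ 2 ^ b.+1)) + \sum_u ((s1 u == v) && odd (T u %/ 2 ^ b.+1))) * 2 ^ b.
    rewrite /X -addnA; congr addn; rewrite -big_split big_distrl -big_split /=.
    apply: eq_bigr => u _; rewrite mod_expnS -divn2 -divnMA -expnS.
    by case: (s0 u == v); case: (s1 u == v); case: odd; rewrite ?andbT ?andbF; lia.
  rewrite (eq_bigr (fun u => ((s0 u == v) && odd (T u %/ 2 ^ b.+1)) : nat)); last by move=> u _; rewrite RB.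
  rewrite [in X in _ + X = _](eq_bigr (fun u => ((s1 u == v) && odd (T u %/ 2 ^ b.+1)) : nat)); last by move=> u _; rewrite RB.
  move: XS; rewrite {1}(divn_eq (X v b.+1) (2 ^ b.+1)) Xmod // mod_expnS.
  rewrite {1}(divn_eq (X v b) (2 ^ b)) Xmod // -/(C v b) -/(C v b.+1) addnA [RHS]addnAC => /eqP; rewrite eqn_add2r => /eqP.
  rewrite expnS mulnA -!mulnDl => /eqP; rewrite eqn_pmul2r // => /eqP; rewrite -addnA => <-.
  by rewrite -muln2 addnC.
- move=> Sv; rewrite RC //.
  (* All halves are below [2 ^ n], so nothing is truncated any more, and [T v < 2 ^ n] leaves no
     carry. *)
  have XT : X v n = T v.
    rewrite -(TE v Sv) /inflow /X /I -addnA -big_split; congr addn; apply: eq_bigr => u _.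
    rewrite modn_small; last by apply: leq_ltn_trans (Tb u); rewrite -divn2 leq_div.
    by rewrite /= uphalf_half; case: (s0 u == v); case: (s1 u == v); lia.
  by rewrite /C XT divn_small.
Qed.

End BinaryCertificate.

(** * Counting formulas and counter machines *)

Definition upd (e : nat -> nat) i k := fun j => if j == i then k else e j.

Lemma upd_eq e i k : upd e i k i = k. Proof. by rewrite /upd eqxx. Qed.
Lemma upd_neq e i k j : j != i -> upd e i k j = e j. Proof. by rewrite /upd => /negbTE ->. Qed.

(* A word over {0, 1, #} with # represented by None; reading past its end yields None at the outer level. *)
Definition word := seq (option bool).
Definition letter := option (option bool).
Definition letter_at (w : word) j : letter := nth None (map Some w) j.

Inductive form :=
| FLt of nat & nat
| FLetter of nat & letter
| FNot of form
| FAnd of form & form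
| FCnt of nat & form & nat.

Fixpoint sat (w : word) (e : nat -> nat) f : bool :=
  match f with
  | FLt i j => e i < e j
  | FLetter i a => letter_at w (e i) == a
  | FNot f => ~~ sat w e f
  | FAnd f g => sat w e f && sat w e g
  | FCnt v f c => count (fun k => sat w (upd e v k) f) (iota 0 (size w)) == e c
  end.

(* The free variables lie below d, and a binder nested k deep binds the variable d + k. *)
Fixpoint scoped d f : bool :=
  match f with
  | FLt i j => (i < d) && (j < d)
  | FLetter i _ => i < d
  | FNot f => scoped d f
  | FAnd f g => scoped d f && scoped d g
  | FCnt v f c => [&& v == d, c < d & scoped d.+1 f]
  end.

Inductive instr (Q : Type) :=
| IZero of nat & Q
| IInc of nat & Q
| ILt of nat & nat & Q & Q
| ILetter of nat & letter & Q & Q.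

Definition imap Q Q' (f : Q -> Q') (c : instr Q) : instr Q' :=
  match c with
  | IZero i q => IZero i (f q)
  | IInc i q => IInc i (f q)
  | ILt i j q q' => ILt i j (f q) (f q')
  | ILetter i a q q' => ILetter i a (f q) (f q')
  end.

(* Counter machines: the states inr b are the two exits. *)
Definition cm_exec (w : word) Q (c : instr Q) (m : nat -> nat) : Q * (nat -> nat) :=
  match c with
  | IZero i q => (q, upd m i 0)
  | IInc i q => (q, upd m i (minn (m i).+1 (size w)))
  | ILt i j q q' => (if m i < m j then q else q', m)
  | ILetter i a q q' => (if letter_at w (m i) == a then q else q', m)
  end.

Definition cm_step (w : word) Q (code : Q -> instr (Q + bool)) (s : (Q + bool) * (nat -> nat)) :=
  match s.1 with
  | inl q => cm_exec w (code q) s.2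
  | inr _ => s
  end.

Definition cm_code (Q : Type) := Q -> instr (Q + bool).

Definition cm_reach w Q (code : cm_code Q) t s s' :=
  exists2 i, i <= t & iter i (@cm_step w Q code) s = s'.

Lemma cm_reach_trans w Q (code : cm_code Q) t1 t2 s1 s2 s3 :
  cm_reach w code t1 s1 s2 -> cm_reach w code t2 s2 s3 -> cm_reach w code (t1 + t2) s1 s3.
Proof.
move=> [i it <-] [j jt <-]; exists (i + j); first exact: leq_add.
by rewrite addnC iterD.
Qed.

Lemma cm_reach1 w Q (code : cm_code Q) q m s :
  cm_exec w (code q) m = s -> cm_reach w code 1 (inl q, m) s.
Proof. by move=> <-; exists 1. Qed.

Lemma cm_reach0 w Q (code : cm_code Q) s : cm_reach w code 0 s s.
Proof. by exists 0. Qed.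

Lemma cm_reachW w Q (code : cm_code Q) t t' s s' :
  t <= t' -> cm_reach w code t s s' -> cm_reach w code t' s s'.
Proof. by move=> tt [i it E]; exists i => //; apply: leq_trans tt. Qed.

(** Runs a machine as a subroutine, with [g] redirecting its exits. The subroutine idles at an exit
    while the host may go on, so times are upper bounds. *)
Lemma cm_reach_embed w Q1 Q (code1 : cm_code Q1) (code : cm_code Q) (f : Q1 -> Q) (g : Q1 + bool -> Q + bool) :
  (forall q, g (inl q) = inl (f q)) ->
  (forall q, code (f q) = imap g (code1 q)) ->
  forall t s m s' m', cm_reach w code1 t (s, m) (s', m') -> cm_reach w code t (g s, m) (g s', m').
Proof.
move=> gf cf t s m s' m' [i it E]; apply: cm_reachW it _.
elim: i s m E => [|i IH] s m; first by case=> -> ->; apply: cm_reach0.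
rewrite iterSr; case: s => [q|b] /= E; last exact: cm_reachW (leqnSn i) (IH _ _ E).
rewrite gf -add1n; move: E; rewrite /cm_step /=.
case E1 : (cm_exec w (code1 q) m) => [s1 m1] /IH; apply: cm_reach_trans.
apply: cm_reach1; rewrite cf.
by case: (code1 q) E1 => [i1 q1|i1 q1|i1 i2 q1 q2|i1 a q1 q2] /= [<- <-] //; case: ifP.
Qed.

(* Variable v is held in the counter 2 v; the odd counters hold the running values of FCnt. *)
Definition cm_decides d f Q (q0 : Q) (code : cm_code Q) (t : nat -> nat) :=
  forall w e m, (forall v, v < d -> m v.*2 = e v) ->
  exists2 m', cm_reach w code (t (size w)) (inl q0, m) (inr (sat w e f), m') &
    forall i, i < d.*2 -> m' i = m i.

Definition cm_decidable d f :=
  exists (Q : finType) (q0 : Q) (code : cm_code Q) c k, cm_decides d f q0 code (fun N => c * N.+1 ^ k).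

Lemma cm_decidable_test d f (c : instr bool) :
  (forall w e m, (forall v, v < d -> m v.*2 = e v) -> cm_exec w c m = (sat w e f, m)) ->
  cm_decidable d f.
Proof.
move=> H; exists unit, tt, (fun=> imap inr c), 1, 0 => w e m me; exists m => //.
apply: cm_reach1; have := H w e m me.
by case: (c) => [i q|i q|i j q q'|i a q q'] /=; try case: ifP => _; case=> <- // ->.
Qed.

Lemma cm_decidable_not d f : cm_decidable d f -> cm_decidable d (FNot f).
Proof.
move=> [Q [q0 [code [c [k H]]]]].
pose g (s : Q + bool) := match s with inl q => inl q | inr b => inr (~~ b) end.
exists Q, q0, (fun q => imap g (code q)), c, k => w e m /H-/(_ w)[m' R P]; exists m' => //.
by apply: (cm_reach_embed (f := id) (g := g) _ _ R).
Qed.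

Lemma cm_decidable_and d f g : cm_decidable d f -> cm_decidable d g -> cm_decidable d (FAnd f g).
Proof.
move=> [Q [q0 [code [c [k H]]]]] [Q' [q0' [code' [c' [k' H']]]]].
pose g1 (s : Q + bool) : Q + Q' + bool :=
  match s with inl q => inl (inl q) | inr b => if b then inl (inr q0') else inr false end.
pose g2 (s : Q' + bool) : Q + Q' + bool :=
  match s with inl q => inl (inr q) | inr b => inr b end.
pose cd (s : Q + Q') := match s with inl q => imap g1 (code q) | inr q => imap g2 (code' q) end.
exists (Q + Q')%type, (inl q0), cd, (c + c'), (k + k').
move=> w e m me; have [m1 R1 P1] := H w e m me.
have me1 v : v < d -> m1 v.*2 = e v by move=> vd; rewrite P1 ?me // ltn_double.
have [m2 R2 P2] := H' w e m1 me1.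
have {}R1 := cm_reach_embed (code := cd) (f := inl) (g := g1) (fun=> erefl) (fun=> erefl) R1.
have {}R2 := cm_reach_embed (code := cd) (f := inr) (g := g2) (fun=> erefl) (fun=> erefl) R2.
have le1 : c * (size w).+1 ^ k <= (c + c') * (size w).+1 ^ (k + k').
  by apply: leq_mul; rewrite ?leq_addr // leq_pexp2l // leq_addr.
move: R1 => /=; case: (sat w e f) => R1; last first.
  by exists m1 => //; apply: cm_reachW le1 R1.
exists m2 => [|i id]; last by rewrite P2 ?P1.
apply: cm_reachW (cm_reach_trans R1 R2).
by rewrite mulnDl leq_add // leq_mul2l leq_pexp2l ?leq_addl ?leq_addr ?orbT.
Qed.

(** A loop over all positions: counter [d.*2] is the bound variable and counter [d.*2.+1] the
    running count, which the machine for [f] preserves. *)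
Lemma cm_decidable_cnt d f x : x < d -> cm_decidable d.+1 f -> cm_decidable d (FCnt d f x).
Proof.
move=> xd [Q [q0 [code [c [k H]]]]].
pose St : finType := (Q + 'I_7)%type.
pose st i : St + bool := inl (inr (inord i)).
pose acc := d.*2.+1.
pose g (s : Q + bool) : St + bool := match s with inl q => inl (inl q) | inr b => if b then st 3 else st 4 end.
(* States 0 and 1 reset, 2 tests for the end of the word, 3 counts, 4 advances, and 5 and 6 compare
   the count with [x]. *)
pose aux i := match i with
  | 0 => IZero acc (st 1)
  | 1 => IZero d.*2 (st 2)
  | 2 => ILetter d.*2 None (st 5) (g (inl q0))
  | 3 => IInc acc (st 4)
  | 4 => IInc d.*2 (st 2)
  | 5 => ILt acc x.*2 (inr false) (st 6)
  | _ => ILt x.*2 acc (inr false) (inr true)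
  end.
pose cd (s : St) := match s with inl q => imap g (code q) | inr i => aux i end.
exists St, (inr (inord 0)), cd, (c + 8), k.+1 => w e m me.
set N := size w.
pose P j := count (fun i => sat w (upd e d i) f) (iota 0 j).
have step i m1 s : i < 7 -> cm_exec w (aux i) m1 = s -> cm_reach w cd 1 (st i, m1) s.
  by move=> i7 E; apply: cm_reach1; rewrite /cd inordK.
pose inv j (m1 : nat -> nat) := [/\ forall i, i < d.*2 -> m1 i = m i, m1 acc = P j & m1 d.*2 = j].
have loop j : j <= N -> exists2 m1, cm_reach w cd (2 + j * (c * N.+1 ^ k + 3)) (st 0, m) (st 2, m1) & inv j m1.
  elim: j => [|j IH] jN.
    exists (upd (upd m acc 0) d.*2 0).
      by apply: (cm_reach_trans (t1 := 1) (t2 := 1)); apply: step.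
    split=> [i id||]; rewrite ?upd_eq //.
      by rewrite !upd_neq //; apply/eqP; rewrite /acc; lia.
    by rewrite upd_neq ?upd_eq // /acc; apply/eqP; lia.
  have [m1 R1 [I1 I2 I3]] := IH (ltnW jN).
  have [|m2 R2 P2] := H w (upd e d j) m1.
    move=> v; rewrite ltnS leq_eqVlt => /orP[/eqP ->|vd]; first by rewrite upd_eq.
    by rewrite upd_neq ?I1 ?me ?ltn_double // neq_ltn vd.
  have {}R2 := cm_reach_embed (code := cd) (f := inl) (g := g) (fun=> erefl) (fun=> erefl) R2.
  have m2d : m2 d.*2 = j by rewrite P2 //; lia.
  have m2a : m2 acc = P j by rewrite P2 // /acc; lia.
  have Ple i : P i <= i by apply: leq_trans (count_size _ _) _; rewrite size_iota.
  have PS : P j.+1 = P j + sat w (upd e d j) f by rewrite /P -addn1 iotaD count_cat /= addn0.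
  have test : cm_reach w cd 1 (st 2, m1) (g (inl q0), m1).
    apply: step => //=; rewrite I3 /letter_at (nth_map None) //.
  pose m3 := if sat w (upd e d j) f then upd m2 acc (P j).+1 else m2.
  (* The count is at most [j < N], so the cap of [IInc] leaves the increment exact. *)
  have R3 : cm_reach w cd 1 (g (inr (sat w (upd e d j) f)), m2) (st 4, m3).
    rewrite /m3; case: sat => /=; last exact: cm_reachW (cm_reach0 _ _ _).
    apply: step => //=; rewrite m2a (minn_idPl _) //.
    by apply: leq_ltn_trans jN; apply: Ple.
  have m3i i : i < acc -> m3 i = m2 i by rewrite /m3; case: sat => // ia; rewrite upd_neq // neq_ltn ia.
  exists (upd m3 d.*2 j.+1); last first.
    split=> [i id||]; last by rewrite upd_eq.
      rewrite upd_neq ?neq_ltn ?id // m3i ?P2 ?I1 // /acc; lia.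
    rewrite upd_neq /acc ?neq_ltn ?ltnSn ?orbT // PS /m3.
    by case: sat; rewrite ?upd_eq ?m2a ?addn1 ?addn0.
  have R4 : cm_reach w cd 1 (st 4, m3) (st 2, upd m3 d.*2 j.+1).
    by apply: step => //=; rewrite m3i ?m2d ?(minn_idPl _) // /acc.
  apply: cm_reachW (cm_reach_trans R1 (cm_reach_trans test (cm_reach_trans R2 (cm_reach_trans R3 R4)))).
  by rewrite -/N; lia.
have [m1 R [I1 I2 I3]] := loop N (leqnn N).
exists m1 => //.
have R5 : cm_reach w cd 1 (st 2, m1) (st 5, m1).
  by apply: step => //=; rewrite I3 /letter_at nth_default ?size_map.
have R6 : cm_reach w cd 2 (st 5, m1) (inr (P N == e x), m1).
  have m1x : m1 x.*2 = e x by rewrite I1 ?me ?ltn_double.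
  have [lt|ge] := ltnP (P N) (e x).
    rewrite (ltn_eqF lt); apply: (@cm_reachW _ _ _ 1) => //.
    by apply: step => //=; rewrite I2 m1x lt.
  apply: (cm_reach_trans (t1 := 1) (t2 := 1) (s2 := (st 6, m1))).
    by apply: step => //=; rewrite I2 m1x ltnNge ge.
  apply: step => //=; rewrite I2 m1x; case: ltngtP ge => //.
apply: cm_reachW (cm_reach_trans R (cm_reach_trans R5 R6)).
have := expn_gt0 N.+1 k; rewrite -/N expnS; nia.
Qed.

Lemma scoped_decidable d f : scoped d f -> cm_decidable d f.
Proof.
elim: f d => [i j|i a|f IH|f IHf g IHg|v f IH x] d /=.
- move=> /andP[id jd]; apply: (@cm_decidable_test _ _ (ILt i.*2 j.*2 true false)) => w e m me /=.
  by rewrite !me //; case: ifP.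
- move=> id; apply: (@cm_decidable_test _ _ (ILetter i.*2 a true false)) => w e m me /=.
  by rewrite !me //; case: ifP.
- by move=> /IH; apply: cm_decidable_not.
- by move=> /andP[/IHf Hf /IHg]; apply: cm_decidable_and.
- by move=> /and3P[/eqP -> xd /IH]; apply: cm_decidable_cnt.
Qed.

(** * Simulation by Turing machines *)

Definition instr_fits K Q (c : instr Q) :=
  match c with
  | IZero i _ => i < K
  | IInc i _ => i < K
  | ILt i j _ _ => (i < K) && (j < K)
  | ILetter i _ _ _ => i < K
  end.

Section Simulation.
Variables (Q : finType) (q0 : Q) (code : cm_code Q) (K : nat).
Hypothesis fits : forall q, instr_fits K (code q).

(* A cell holds its letter, a flag for the leftmost cell, and the set of counters whose value is its position. *)
Definition cell : finType := (letter * bool * K.-tuple bool)%type.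

Definition mark i (x : cell) := nth false x.2 i.
Definition set_mark i b (x : cell) : cell :=
  (x.1, [tuple if val k == i then b else tnth x.2 k | k < K]).

(* One left-to-right sweep performs one instruction. For IInc the memory Some true
   carries the mark to the next cell; for the tests it records the outcome. *)
Definition sweep (c : instr (Q + bool)) (o : option bool) (x : cell) : option bool * cell :=
  match c with
  | IZero i _ => (None, set_mark i x.1.2 x)
  | IInc i _ =>
    if mark i x && (x.1.1 != None) then (Some true, set_mark i false x)
    else (None, if o == Some true then set_mark i true x else x)
  | ILt i j _ _ =>
    (if o is None then if mark j x then Some false else if mark i x then Some true else None
     else o, x)
  | ILetter i a _ _ => (if mark i x then Some (x.1.1 == a) else o, x)
  end.

Definition exit (c : instr (Q + bool)) (o : option bool) : Q + bool :=
  match c with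
  | IZero _ q => q
  | IInc _ q => q
  | ILt _ _ q q' => if o == Some true then q else q'
  | ILetter _ _ q q' => if o == Some true then q else q'
  end.

Definition sim_state : finType := (bool + (Q + bool) * option (option bool))%type.
Definition sim_sym : finType := option cell.

(** [inl false] puts all counters on the leftmost cell, and [inl true] walks to the first blank and
    turns it into the end cell of position [N]. For a state [q], memory [None] means rewinding and
    [Some o] sweeping right with memory [o]. *)
Definition sim_delta (s : sim_state) (a : sim_sym) : sim_state * sim_sym * tm_move :=
  match s, a with
  | inl false, Some x => (inl true, Some (x.1.1, true, [tuple true | _ < K]), MoveR)
  | inl true, Some x => (inl true, Some x, MoveR)
  | inl true, None => (inr (inl q0, None), Some (None, false, [tuple false | _ < K]), Stay)
  | inr (inl q, None), Some x =>
    if x.1.2 then (inr (inl q, Some None), Some x, Stay) else (s, Some x, MoveL)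
  | inr (inl q, Some o), Some x =>
    let: (o', x') := sweep (code q) o x in
    if x.1.1 == None then (inr (exit (code q) o', None), Some x', Stay)
    else (inr (inl q, Some o'), Some x', MoveR)
  | _, _ => (s, a, Stay)
  end.

Definition input_sym (a : option bool) : sim_sym := Some (Some a, false, [tuple false | _ < K]).

Definition sim_tm : TM := {|
  tm_blank := None : sim_sym;
  tm_sym0 := input_sym (Some false);
  tm_sym1 := input_sym (Some true);
  tm_sep := input_sym None;
  tm_start := inl false : sim_state;
  tm_accept := inr (inr true, None) : sim_state;
  tm_delta := sim_delta |}.

Section Word.
Variable w : word.
Hypothesis w_gt0 : 0 < size w.
Local Notation N := (size w).

Definition cell_at (m : nat -> nat) j : cell := (letter_at w j, j == 0, [tuple m k == j | k < K]).

Lemma letter_at_None j : j <= N -> (letter_at w j == None) = (j == N).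
Proof.
rewrite leq_eqVlt => /orP[/eqP ->|jN]; first by rewrite /letter_at nth_default ?size_map ?eqxx.
by rewrite /letter_at (nth_map None) // (ltn_eqF jN).
Qed.

Lemma mark_cell_at i m j : i < K -> mark i (cell_at m j) = (m i == j).
Proof. by move=> iK; rewrite /mark /= (nth_map (Ordinal iK)) ?nth_enum_ord ?size_enum_ord. Qed.

Lemma set_mark_cell_at i b m m' j : (forall k, k != i -> m' k = m k) -> (m' i == j) = b ->
  set_mark i b (cell_at m j) = cell_at m' j.
Proof.
move=> mm bE; rewrite /cell_at /set_mark /=; congr (_, _); apply: eq_from_tnth => k.
by rewrite !tnth_mktuple; case: eqP => [->|/eqP/mm ->].
Qed.

(** The memory of the sweep when it reaches cell [j], in terms of the counter values before the
    instruction. *)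
Definition memory_at (c : instr (Q + bool)) (m : nat -> nat) j : option bool :=
  match c with
  | IZero _ _ => None
  | IInc i _ => if ((m i).+1 == j) && (m i < N) then Some true else None
  | ILt i i' _ _ => if minn (m i) (m i') < j then Some (m i < m i') else None
  | ILetter i a _ _ => if m i < j then Some (letter_at w (m i) == a) else None
  end.

Lemma sweep_cell_at c m j : instr_fits K c -> (forall i, m i <= N) -> j <= N ->
  sweep c (memory_at c m j) (cell_at m j) = (memory_at c m j.+1, cell_at (cm_exec w c m).2 j).
Proof.
move=> + mN jN; case: c => [i q|i q|i i' q q'|i a q q'] /=.
- move=> iK; congr (_, _); apply: set_mark_cell_at => [k ki|]; first by rewrite upd_neq.
  by rewrite upd_eq eq_sym.
(* The mark leaves cell [m i] for the next one, except on the end cell, where it stays: this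
   realizes the cap at [N]. *)
- move=> iK; rewrite mark_cell_at // letter_at_None //.
  have E : cell_at (upd m i (minn (m i).+1 N)) j = set_mark i (minn (m i).+1 N == j) (cell_at m j).
    by apply/esym/set_mark_cell_at => [k ki|]; [rewrite upd_neq | rewrite upd_eq].
  have E0 : set_mark i (m i == j) (cell_at m j) = cell_at m j by apply: set_mark_cell_at.
  have := mN i; rewrite eqSS E /= -[in X in _ -> (if _ then _ else (_, if _ then _ else X)) = _]E0.
  case: (ltngtP (m i) j) => mj mi /=.
  + case: ((m i).+1 =P j) => [mSj|mSj] /=.
      have mlt : m i < N by lia.
      by rewrite mlt /=; congr (_, set_mark _ _ _); rewrite /minn; case: ifP; lia.
    by congr (_, set_mark _ _ _); rewrite /minn; case: ifP; lia.
  + have -> : ((m i).+1 == j) = false by lia.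
    by congr (_, set_mark _ _ _); rewrite /minn; case: ifP; lia.
  + have -> : ((m i).+1 == j) = false by lia.
    rewrite mj; case: (ltngtP j N) jN => // jN _ /=; congr (_, set_mark _ _ _); rewrite /minn; case: ifP; lia.
- move=> /andP[iK i'K]; rewrite !mark_cell_at //; congr (_, _).
  case: ifP => [mj|mj]; first by rewrite (leq_trans mj).
  rewrite ltnS; move: mj; rewrite /minn.
  by case: (ltngtP (m i) (m i')); case: (ltngtP (m i) j); case: (ltngtP (m i') j) => //=; lia.
- move=> iK; rewrite mark_cell_at // ltnS.
  by case: (ltngtP (m i) j) => [||->].
Qed.

(** All counters are at most [N], so past the end cell every mark has been seen and each test is
    settled. *)
Lemma exit_memory c m : (forall i, m i <= N) -> exit c (memory_at c m N.+1) = (cm_exec w c m).1.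
Proof.
move=> mN; case: c => [i q|i q|i i' q q'|i a q q'] //=.
- by rewrite ltnS geq_min mN; case: (_ < _).
- by rewrite ltnS mN; case: (letter_at _ _ == a).
Qed.

Lemma rev_map_iotaS T (f : nat -> T) j : rev (map f (iota 0 j.+1)) = f j :: rev (map f (iota 0 j)).
Proof. by rewrite -addn1 iotaD map_cat rev_cat. Qed.

Definition sym_at m j : sim_sym := Some (cell_at m j).

Definition sim_config (s : Q + bool) m : tm_config sim_tm :=
  (inr (s, None) : sim_state, rev (map (sym_at m) (iota 0 N)), sym_at m N, [::]).

(** Invariant of the sweep: the cells behind the head carry the new counter values, the others the
    old ones. *)
Lemma sim_right q m j : (forall i, m i <= N) -> j <= N ->
  iter (N - j).+1 (@tm_step sim_tm)
    (inr (inl q, Some (memory_at (code q) m j)) : sim_state,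
     rev (map (sym_at (cm_exec w (code q) m).2) (iota 0 j)), sym_at m j,
     map (sym_at m) (iota j.+1 (N - j)))
  = sim_config (cm_exec w (code q) m).1 (cm_exec w (code q) m).2.
Proof.
move=> mN jN; move kE: (N - j) => k; elim: k j jN kE => [|k IH] j jN kE.
  have -> : j = N by lia.
  by rewrite /= sweep_cell_at // letter_at_None // eqxx exit_memory.
rewrite iterSr -(IH j.+1); [|lia|lia].
congr (iter _ _ _); rewrite [LHS]/= sweep_cell_at // letter_at_None //.
have -> : (j == N) = false by lia.
by rewrite rev_map_iotaS.
Qed.

Lemma sim_left q m j r :
  iter j.+1 (@tm_step sim_tm)
    (inr (inl q, None) : sim_state, rev (map (sym_at m) (iota 0 j)), sym_at m j, r)
  = (inr (inl q, Some None) : sim_state, [::], sym_at m 0, map (sym_at m) (iota 1 j) ++ r).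
Proof.
elim: j r => [|j IH] r //.
rewrite iterSr rev_map_iotaS -{3}(addn1 j) iotaD map_cat -catA add1n.
by rewrite -(IH (sym_at m j.+1 :: r)).
Qed.

Lemma memory_at0 c m : memory_at c m 0 = None.
Proof. by case: c. Qed.

Lemma sim_cycle q m : (forall i, m i <= N) ->
  iter (N.+1 + N.+1) (@tm_step sim_tm) (sim_config (inl q) m)
  = sim_config (cm_exec w (code q) m).1 (cm_exec w (code q) m).2.
Proof.
move=> mN; rewrite iterD sim_left cats0 -(sim_right q mN (leq0n N)).
by rewrite subn0 memory_at0.
Qed.

Lemma cm_exec_le (c : instr (Q + bool)) m : (forall i, m i <= N) -> forall i, (cm_exec w c m).2 i <= N.
Proof.
move=> mN k; case: c => [i q|i q|i i' q q'|i a q q'] //=; rewrite /upd; case: eqP => // _.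
exact: geq_minr.
Qed.

Lemma sim_reach t s m s' m' : (forall i, m i <= N) -> cm_reach w code t (s, m) (s', m') ->
  exists2 i, i <= t * (N.+1 + N.+1) & iter i (@tm_step sim_tm) (sim_config s m) = sim_config s' m'.
Proof.
move=> mN [i it E]; elim: i s m t mN it E => [|i IH] s m t mN it.
  by case=> -> ->; exists 0.
case: s => [q|b]; last first.
  rewrite iterSr; apply: (IH _ _ t) => //; exact: ltnW.
case: t it => // t; rewrite ltnS iterSr /cm_step /= => it.
case E1 : (cm_exec w (code q) m) => [s1 m1] /IH-/(_ t)[|//|j jt <-].
  by have := cm_exec_le (code q) mN; rewrite E1.
exists (j + (N.+1 + N.+1)); first by rewrite mulSn addnC leq_add2l.
by rewrite iterD sim_cycle // E1.
Qed.

(** [N] steps cross the word and one more writes the end cell. *)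
Lemma sim_init : iter N.+1 (@tm_step sim_tm) (@tm_init sim_tm (map input_sym w)) = sim_config (inl q0) (fun=> 0).
Proof.
have cellS j : j < N -> sym_at (fun=> 0) j.+1 = if j.+1 == N then Some (None, false, [tuple false | _ < K]) else input_sym (nth None w j.+1).
  move=> jN; rewrite /sym_at /cell_at.
  have -> : [tuple 0 == j.+1 | _ < K] = [tuple false | _ < K] by apply: eq_from_tnth => k; rewrite !tnth_mktuple.
  rewrite (_ : (j.+1 == 0) = false) //; case: (j.+1 =P N) => [->|ne]; first by rewrite /letter_at nth_default ?size_map.
  by rewrite /letter_at (nth_map None) //; lia.
have cell0 : sym_at (fun=> 0) 0 = Some (Some (nth None w 0), true, [tuple true | _ < K]).
  by rewrite /sym_at /cell_at /letter_at (nth_map None).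
have go j : j < N -> iter j.+1 (@tm_step sim_tm) (@tm_init sim_tm (map input_sym w)) =
    (inl true : sim_state, rev (map (sym_at (fun=> 0)) (iota 0 j.+1)),
      head (None : sim_sym) (drop j.+1 (map input_sym w)), behead (drop j.+1 (map input_sym w))).
  elim: j => [|j IH] jN.
    rewrite /= cell0; case: (w) w_gt0 => //= a w' _.
    by rewrite drop0; case: w'.
  rewrite iterS IH ?(ltnW jN) // (drop_nth (None : sim_sym)) ?size_map // (nth_map None) //.
  rewrite (rev_map_iotaS _ j.+1) cellS; last by lia.
  have -> : (j.+1 == N) = false by lia.
  by case: (drop j.+2 _).
rewrite -(prednK w_gt0) iterS go ?prednK // drop_oversize ?size_map //=.
by rewrite /sim_config -(prednK w_gt0) cellS ?prednK // eqxx.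
Qed.

Lemma sim_halted i b m : iter i (@tm_step sim_tm) (sim_config (inr b) m) = sim_config (inr b) m.
Proof. by elim: i => // i IH; rewrite iterS IH. Qed.

End Word.

Lemma sim_accepts (w : word) t b m' t' : 0 < size w ->
  cm_reach w code t (inl q0, fun=> 0) (inr b, m') ->
  (size w).+1 + t * ((size w).+1 + (size w).+1) <= t' ->
  tm_accepts_within (M := sim_tm) (map input_sym w) t' <-> b.
Proof.
move=> w_gt0 /(sim_reach w_gt0 (fun=> leq0n _))[i it E] tt'.
have {}E : iter (i + (size w).+1) (@tm_step sim_tm) (@tm_init sim_tm (map input_sym w)) = sim_config w (inr b) m'.
  by rewrite iterD sim_init.
split=> [[j [_]]|bT]; last first.
  exists (i + (size w).+1); split; first by apply: leq_trans tt'; rewrite addnC leq_add2l.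
  by rewrite E bT.
(* Accepting configurations and exits are both fixed, so the accepting time and the exit time may
   come in either order. *)
have absorb k c : c.1.1.1 = (inr (inr true, None) : sim_state) -> iter k (@tm_step sim_tm) c = c.
  by move: c => [[[s l] h] r] /= ->; elim: k => // k IH; rewrite iterS IH.
move=> acc; have [le|/ltnW le] := leqP j (i + (size w).+1).
  move: E; rewrite -(subnK le) iterD absorb // => E.
  by move: acc; rewrite E => -[].
by move: acc; rewrite -(subnK le) iterD E sim_halted => -[].
Qed.

End Simulation.

(** * From counting formulas to NP *)

Definition input_word (x u : seq bool) : word := map Some x ++ None :: map Some u.

(** The summand 1 covers [s = 0], [a = 0], where [0 ^ 0 = 1]. *)
Lemma expn_mono_succ s a b : a <= b -> s ^ a <= s ^ b + 1.
Proof.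
case: s => [|s] ab; first by case: a ab => [|a] _; rewrite ?leq_addl // (exp0n (ltn0Sn a)).
by apply: leq_trans (leq_addr _ _); rewrite leq_pexp2l.
Qed.

Lemma in_NP_formula (L : seq bool -> Prop) d f c0 k0 :
  scoped d f ->
  (forall x u, sat (input_word x u) (fun=> 0) f -> L x) ->
  (forall x, L x -> exists2 u, size u <= c0 * size x ^ k0 + c0 & sat (input_word x u) (fun=> 0) f) ->
  in_NP L.
Proof.
move=> /scoped_decidable[Q [q0 [code [c [k H]]]]] sound complete.
pose bound (i : instr (Q + bool)) := match i with
  | IZero i _ | IInc i _ | ILetter i _ _ _ => i.+1
  | ILt i j _ _ => maxn i.+1 j.+1 end.
(* The finitely many instructions name only counters below [K]. *)
pose K := \max_q bound (code q).
have fits q : instr_fits K (code q).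
  have : bound (code q) <= K by apply: leq_bigmax.
  by case: (code q) => //= i j _ _; rewrite geq_max.
(* The word has [s.+1] letters for inputs of total size [s]; the power of 3 comes from
   [s.+2 <= 3 * maxn s 1]. *)
pose C := (2 * c + 1) * 3 ^ k.+1.
have time s : s.+2 + c * s.+2 ^ k * (s.+2 + s.+2) <= C * s ^ k.+1 + C.
  apply: (@leq_trans ((2 * c + 1) * s.+2 ^ k.+1)).
    by rewrite expnS; have := expn_gt0 s.+2 k; nia.
  rewrite -mulnSr /C -mulnA leq_mul2l; apply/orP; right.
  have le3 : s.+2 <= 3 * maxn s 1 by rewrite /maxn; case: ifP; lia.
  apply: (@leq_trans ((3 * maxn s 1) ^ k.+1)); first by rewrite leq_exp2r.
  rewrite expnMn leq_mul2l; apply/orP; right.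
  by rewrite /maxn; case: ifP => _; rewrite ?exp1n // ltnW.
(* One constant and one exponent must serve both the certificate length and the running time. *)
exists (sim_tm q0 code K), (2 * C + 2 * c0), (k.+1 + k0) => x.
have accE u t : C * (size x + size u) ^ k.+1 + C <= t ->
  tm_accepts_within (M := sim_tm q0 code K) (tm_input2 _ x u) t <-> sat (input_word x u) (fun=> 0) f.
  move=> le.
  have sw : size (input_word x u) = (size x + size u).+1.
    by rewrite size_cat /= !size_map addnS.
  have [m' R _] := H (input_word x u) (fun=> 0) (fun=> 0) (fun _ _ => erefl).
  rewrite -(sim_accepts (t' := t) fits _ R) ?sw //; last exact: leq_trans (time _) le.
  have -> : tm_input2 (sim_tm q0 code K) x u = map (input_sym K) (input_word x u) => //.
  rewrite /tm_input2 /input_word map_cat /= -!map_comp.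
  by congr (_ ++ _ :: _); apply: eq_map => -[].
have big s : C * s ^ k.+1 + C <= (2 * C + 2 * c0) * s ^ (k.+1 + k0) + (2 * C + 2 * c0).
  have := expn_mono_succ s (leq_addr k0 k.+1); nia.
split=> [/complete[u su Hu]|[u [_ /accE/sound]]]; last by apply; apply: big.
exists u; split; last by apply/accE => //; apply: big.
apply: leq_trans su _; have := expn_mono_succ (size x) (leq_addl k.+1 k0); nia.
Qed.

(** * Arithmetic in counting formulas *)

Definition isone (a : option bool) := a == Some true.

(* items cuts a word after each symbol other than 1 and lists the lengths of the
   blocks of 1s; acc is the length of the current block, tail the final one. *)
Fixpoint items acc (w : word) : seq nat :=
  match w with
  | [::] => [::]
  | a :: w' => if isone a then items acc.+1 w' else acc :: items 0 w'
  end.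

Definition tail acc (w : word) := foldl (fun c a => if isone a then c.+1 else 0) acc w.

Lemma items_cat acc w1 w2 : items acc (w1 ++ w2) = items acc w1 ++ items (tail acc w1) w2.
Proof. by elim: w1 acc => //= a w1 IH acc; case: ifP => _; rewrite IH. Qed.

Lemma size_items acc w : size (items acc w) = count (predC isone) w.
Proof. by elim: w acc => //= a w IH acc; case: (isone a); rewrite /= IH. Qed.

(** Cutting [w] at the terminator [p] makes the current block the next list entry. With [items_pos],
    formulas can address blocks through the positions that end them. *)
Lemma items_at (w : word) p : p < size w -> ~~ isone (nth None w p) ->
  nth 0 (items 0 w) (size (items 0 (take p w))) = tail 0 (take p w) /\
  size (items 0 (take p w)) < size (items 0 w).
Proof.
move=> pw /negbTE one; have := cat_take_drop p w; rewrite (drop_nth None) //.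
move: (take p w) (nth None w p) one (drop p.+1 w) => w1 a one w2 <-.
rewrite items_cat /= one nth_cat ltnn subnn; split=> //.
by rewrite size_cat /= addnS ltnS leq_addr.
Qed.

Lemma items_pos (w : word) k : k < size (items 0 w) ->
  exists p, [/\ p < size w, ~~ isone (nth None w p) & size (items 0 (take p w)) = k].
Proof.
rewrite size_items; suff H : k < count (predC isone) w -> exists p,
    [/\ p < size w, ~~ isone (nth None w p) & count (predC isone) (take p w) = k].
  by move=> /H[p [pw one c]]; exists p; rewrite size_items.
elim: w k => //= a w IH k; case: (boolP (isone a)) => /= [one|one] kc.
  by have [p [? ? ?]] := IH k kc; exists p.+1; split=> //=; rewrite one.
case: k kc => [|k] kc; first by exists 0.
by have [p [? ? <-]] := IH k kc; exists p.+1; split=> //=; rewrite one.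
Qed.

(** Presents a block length as a number of positions, which [FCnt] can express. *)
Lemma tail_count (w : word) :
  count (fun q => all isone (drop q w)) (iota 0 (size w)) = tail 0 w.
Proof.
elim/last_ind: w => // w a IH; rewrite size_rcons -addn1 iotaD count_cat /= add0n addn0.
rewrite -cats1 /tail foldl_cat -/(tail 0 w) /= drop_size_cat //= andbT.
rewrite (eq_in_count (a2 := fun q => isone a && all isone (drop q w))); last first.
  by move=> q; rewrite mem_iota /= => qw; rewrite drop_cat qw all_cat /= andbT andbC.
case: (isone a); first by rewrite IH addn1.
by rewrite count_pred0.
Qed.

Lemma count_iota_take (w : word) (P : pred (option bool)) p : p <= size w ->
  count (fun q => (q < p) && P (nth None w q)) (iota 0 (size w)) = count P (take p w).
Proof.
move=> pw; rewrite -{1}(subnKC pw) iotaD count_cat [X in _ + X](_ : _ = 0); last first.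
  by apply/eqP; rewrite -leqn0 leqNgt -has_count; apply/hasPn => q; rewrite mem_iota /=; lia.
rewrite addn0 -(map_nth_iota0 None pw) count_map; apply: eq_in_count => q.
by rewrite mem_iota /= => ->.
Qed.

Definition item (l : seq nat) k a := (k < size l) && (nth 0 l k == a).

Definition FImp f g := FNot (FAnd f (FNot g)).
Definition FOr f g := FNot (FAnd (FNot f) (FNot g)).
Definition FEq i j := FAnd (FNot (FLt i j)) (FNot (FLt j i)).
(* Variable 0 is a constant of value 0. *)
Definition FAll v f := FCnt v (FNot f) 0.
Definition FEx v f := FNot (FAll v (FNot f)).

Lemma upd_lt e i k j : j < i -> upd e i k j = e j.
Proof. by move=> ji; rewrite upd_neq // neq_ltn ji. Qed.

Section Macros.
Variable w : word.
Local Notation N := (size w).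
Local Notation sat := (sat w).
Implicit Types (e : nat -> nat) (f g : form).

Lemma sat_not e f : sat e (FNot f) = ~~ sat e f.
Proof. by []. Qed.

Lemma sat_and e f g : sat e (FAnd f g) = sat e f && sat e g.
Proof. by []. Qed.

Lemma sat_lt e i j : sat e (FLt i j) = (e i < e j).
Proof. by []. Qed.

Lemma sat_imp e f g : sat e (FImp f g) = (sat e f ==> sat e g).
Proof. by rewrite /= negb_and negbK implybE. Qed.

Lemma sat_or e f g : sat e (FOr f g) = sat e f || sat e g.
Proof. by rewrite /= negb_and !negbK. Qed.

Lemma sat_eq e i j : sat e (FEq i j) = (e i == e j).
Proof. by rewrite /= -!leqNgt andbC -eqn_leq. Qed.

Lemma sat_all e v f : e 0 = 0 -> sat e (FAll v f) = all (fun k => sat (upd e v k) f) (iota 0 N).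
Proof. by move=> /= ->; rewrite -[LHS]negbK -lt0n -has_count -all_predC; apply: eq_all => k /=; rewrite negbK. Qed.

Lemma sat_ex e v f : e 0 = 0 -> sat e (FEx v f) = has (fun k => sat (upd e v k) f) (iota 0 N).
Proof. by move=> e0; rewrite (_ : sat e (FEx v f) = ~~ sat e (FAll v (FNot f))) // sat_all // -has_predC; apply: eq_has => k /=; rewrite negbK. Qed.

Lemma sat_exP e v f : e 0 = 0 -> reflect (exists2 k, k < N & sat (upd e v k) f) (sat e (FEx v f)).
Proof.
move=> e0; rewrite sat_ex //; apply: (iffP hasP) => -[k].
  by rewrite mem_iota => kN; exists k.
by move=> kN; exists k; rewrite ?mem_iota.
Qed.

Lemma sat_allP e v f : e 0 = 0 -> reflect (forall k, k < N -> sat (upd e v k) f) (sat e (FAll v f)).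
Proof.
move=> e0; rewrite sat_all //; apply: (iffP allP) => H k kN; apply: H; move: kN; by rewrite mem_iota.
Qed.

Lemma sat_cnt e v f x (P : pred nat) : (forall k, k < N -> sat (upd e v k) f = P k) ->
  sat e (FCnt v f x) = (count P (iota 0 N) == e x).
Proof. by move=> fP; congr (_ == _); apply: eq_in_count => k; rewrite mem_iota => /fP. Qed.

(** Addition by counting the interval from [i] to [k], which must consist of positions of the
    word. *)
Definition FAdd d i j k := FAnd (FNot (FLt k i)) (FCnt d (FAnd (FNot (FLt d i)) (FLt d k)) j).

Lemma sat_add e d i j k : i < d -> j < d -> k < d -> e k <= N ->
  sat e (FAdd d i j k) = (e i + e j == e k).
Proof.
move=> id jd kd kN; rewrite /FAdd /= -leqNgt.
rewrite (eq_count (a2 := fun x => (e i <= x) && (x < e k))); last first.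
  by move=> x; rewrite upd_eq !upd_lt // -leqNgt.
have [ik|ik] /= := leqP (e i) (e k); last by apply/esym/eqP; lia.
have -> : N = e i + (e k - e i) + (N - e k) by lia.
rewrite !iotaD !count_cat (_ : count _ (iota 0 _) = 0); last first.
  by apply/eqP; rewrite -leqn0 leqNgt -has_count; apply/hasPn => q; rewrite mem_iota /=; lia.
rewrite [X in _ + X](_ : _ = 0); last first.
  by apply/eqP; rewrite -leqn0 leqNgt -has_count; apply/hasPn => q; rewrite mem_iota /=; lia.
rewrite (_ : count _ _ = e k - e i); first by apply/eqP/eqP; lia.
rewrite -[RHS](size_iota (0 + e i)); apply/eqP; rewrite -all_count.
by apply/allP => q; rewrite mem_iota; lia.
Qed.

(** Variables range over positions, so this is false when the sum is not below [N]; long words keep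
    the sums in range. *)
Definition FLetAdd v i j f := FEx v (FAnd (FAdd v.+1 i j v) f).

Lemma sat_letadd e v i j f : e 0 = 0 -> i < v -> j < v ->
  sat e (FLetAdd v i j f) = (e i + e j < N) && sat (upd e v (e i + e j)) f.
Proof.
move=> e0 iv jv.
have addE k : k < N -> sat (upd e v k) (FAdd v.+1 i j v) = (e i + e j == k).
  move=> kN; rewrite sat_add ?upd_eq ?(ltnW kN) // 1?ltnW //.
  by rewrite !upd_lt.
apply/sat_exP/andP => // [[k kN]|[kN H]].
  by rewrite sat_and addE // => /andP[/eqP ->].
by exists (e i + e j) => //; rewrite sat_and addE ?eqxx.
Qed.

Definition FLetCnt v g f := FEx v (FAnd (FCnt v.+1 g v) f).

(** [g] is evaluated with the guessed count already bound to [v], hence its truth value must be the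
    same for every [c]. *)
Lemma sat_letcnt e v g f (P : pred nat) : e 0 = 0 ->
  (forall c k, k < N -> sat (upd (upd e v c) v.+1 k) g = P k) ->
  sat e (FLetCnt v g f) = (count P (iota 0 N) < N) && sat (upd e v (count P (iota 0 N))) f.
Proof.
move=> e0 gP.
have cE k : sat (upd e v k) (FCnt v.+1 g v) = (count P (iota 0 N) == k).
  rewrite /= upd_eq; congr (_ == _); apply: eq_in_count => x.
  by rewrite mem_iota => xN; apply: gP.
apply/sat_exP/andP => // [[k kN]|[kN H]].
  by rewrite sat_and cE => /andP[/eqP ->].
by exists (count P (iota 0 N)) => //; rewrite sat_and cE eqxx.
Qed.

Definition FOne i := FLetter i (Some (Some true)).

Lemma sat_one e i : e i < N -> sat e (FOne i) = isone (nth None w (e i)).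
Proof. by move=> iN; rewrite /= /letter_at (nth_map None). Qed.

(* The position p is the end of the block number x. *)
Definition FEnds d p x := FCnt d (FAnd (FLt d p) (FNot (FOne d))) x.

Lemma sat_ends e d p x : p < d -> e p <= N ->
  sat e (FEnds d p x) = (size (items 0 (take (e p) w)) == e x).
Proof.
move=> pd pN; rewrite size_items -(count_iota_take _ pN) /FEnds; congr (_ == _).
apply: eq_in_count => q; rewrite mem_iota /= => qN.
by rewrite upd_eq upd_lt // /letter_at (nth_map None).
Qed.

(** [d] guesses the position ending block [k]; [a] is compared with the number of positions from
    which only 1s lead up to it. *)
Definition FItem d k a :=
  FEx d (FAnd (FNot (FOne d)) (FAnd (FEnds d.+1 d k)
    (FCnt d.+1 (FAnd (FLt d.+1 d) (FAll d.+2 (FImp (FAnd (FLt d.+2 d) (FNot (FLt d.+2 d.+1))) (FOne d.+2)))) a))).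

Lemma sat_item e d k a : e 0 = 0 -> 0 < d -> k < d -> a < d ->
  sat e (FItem d k a) = item (items 0 w) (e k) (e a).
Proof.
move=> e0 d0 kd ad; have e10 p : upd e d p 0 = 0 by rewrite upd_lt.
have body p : p < N -> sat (upd e d p) (FAnd (FNot (FOne d)) (FAnd (FEnds d.+1 d k)
    (FCnt d.+1 (FAnd (FLt d.+1 d) (FAll d.+2 (FImp (FAnd (FLt d.+2 d) (FNot (FLt d.+2 d.+1))) (FOne d.+2)))) a))) =
    [&& ~~ isone (nth None w p), size (items 0 (take p w)) == e k & tail 0 (take p w) == e a].
  move=> pN; have pd : upd e d p d = p by rewrite upd_eq.
  rewrite !sat_and sat_not sat_one ?sat_ends ?pd ?(ltnW pN) // (upd_lt _ _ kd).
  congr [&& _, _ & _].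
  rewrite (@sat_cnt _ _ _ _ (fun q => (q < p) && all isone (drop q (take p w)))); last first.
    move=> q qN; rewrite sat_and sat_lt upd_eq (upd_lt _ _ (ltnSn d)) pd.
    case: ltnP => // qp; rewrite !andTb; apply/sat_allP/allP => [|H x|H j jN]; first by rewrite upd_lt.
      have szt : size (drop q (take p w)) = p - q by rewrite size_drop size_takel // ltnW.
      move=> /(nthP None)[r]; rewrite szt => rpq <-.
      have := H (q + r); rewrite sat_imp sat_and sat_not !sat_lt sat_one upd_eq; last lia.
      rewrite !(upd_lt _ _ (ltnSn _)) upd_lt // upd_eq upd_lt // pd nth_drop nth_take; last lia.
      by move=> -/(_ _)/implyP; apply; lia.
    rewrite sat_imp sat_and sat_not !sat_lt sat_one upd_eq //.
    rewrite !(upd_lt _ _ (ltnSn _)) upd_lt // upd_eq upd_lt // pd -leqNgt; apply/implyP => /andP[jp qj].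
    apply: H; apply/(nthP None); exists (j - q).
      by rewrite size_drop size_takel ?(ltnW pN) // ltn_sub2r.
    by rewrite nth_drop subnKC // nth_take.
  rewrite (upd_lt _ _ ad) -tail_count size_takel ?(ltnW pN) // -{1}(subnKC (ltnW pN)) iotaD count_cat; congr (_ == _).
  rewrite [X in _ + X](_ : _ = 0) ?addn0; last first.
    by apply/eqP; rewrite -leqn0 leqNgt -has_count; apply/hasPn => q; rewrite mem_iota /=; lia.
  by apply: eq_in_count => q; rewrite mem_iota add0n => /= ->.
rewrite /FItem sat_ex //; apply/hasP/andP => [[p]|[ks /eqP ka]].
  rewrite mem_iota => pN; rewrite body // => /and3P[one /eqP <- /eqP <-].
  by have [-> ->] := items_at pN one; rewrite eqxx.
have [p [pN one sp]] := items_pos ks; exists p; first by rewrite mem_iota.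
rewrite body // one sp eqxx /= -ka -sp.
by have [-> _] := items_at pN one.
Qed.
End Macros.

(** * The certificate formula *)

Ltac upds := repeat match goal with
  | |- context [upd ?e ?i ?k ?j] =>
    first [rewrite (@upd_eq e i k) | rewrite (@upd_lt e i k j); [|by lia]]
  end.

Ltac letadd := rewrite sat_letadd; [upds | by upds | by lia | by lia].

(* The numbers in l after the position q are read as triples. *)
Definition rel_of l q a b c :=
  has (fun r => [&& item l (q + 3 * r + 1) a, item l (q + 3 * r + 2) b & item l (q + 3 * r + 3) c])
    (iota 0 (size l)).

(* s_i u = v for the instance with list of numbers l and n vertices. *)
Definition arc_of l n (i : bool) u v := (u < n) && item l (u + u + 1 + i) v.

(** The sums run through [2 * r], [3 * r], [q + 3 * r] and the next three indices. *)
Definition FRel d a b c :=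
  FEx d (FLetAdd d.+1 d d (FLetAdd d.+2 d.+1 d (FLetAdd d.+3 d.+2 2 (FLetAdd d.+4 d.+3 1
    (FLetAdd (5 + d) d.+4 1 (FLetAdd (6 + d) (5 + d) 1
      (FAnd (FItem (7 + d) d.+4 a) (FAnd (FItem (7 + d) (5 + d) b) (FItem (7 + d) (6 + d) c))))))))).

Definition FArc d (i : bool) u v :=
  FAnd (FLt u 3) (FLetAdd d u u (FLetAdd d.+1 d 1
    (if i then FLetAdd d.+2 d.+1 1 (FItem d.+3 d.+2 v) else FItem d.+2 d.+1 v))).

Definition FCarry d v b := FAnd (FLt 0 d) (FRel d.+1 v b d).
Definition FArcBit d i v b := FAnd (FArc d.+1 i d v) (FRel d.+1 d b 0).

(** Variables [d.+1] to [d.+4] hold the carry in, the two arc counts and the carry out. The final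
    disjunction adds the bit of [v] to the doubled carry by cases. *)
Definition FColumn d v b :=
  FLetAdd d b 1
  (FLetCnt d.+1 (FCarry d.+2 v b)
  (FLetCnt d.+2 (FArcBit d.+3 false v d)
  (FLetCnt d.+3 (FArcBit d.+4 true v d)
  (FLetCnt d.+4 (FCarry (5 + d) v d)
  (FLetAdd (5 + d) d.+1 d.+2
  (FLetAdd (6 + d) (5 + d) d.+3
  (FLetAdd (7 + d) d.+4 d.+4
  (FLetAdd (8 + d) (7 + d) 1
    (FOr (FAnd (FRel (9 + d) v b 0) (FEq (8 + d) (6 + d)))
         (FAnd (FNot (FRel (9 + d) v b 0)) (FEq (7 + d) (6 + d)))))))))))).

Section CertificateFormula.
Variable w : word.
Local Notation N := (size w).
Local Notation sat := (sat w).
Local Notation L := (items 0 w).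

Lemma size_items_le : size L <= N.
Proof. by rewrite size_items count_size. Qed.

Section Env.
Variable e : nat -> nat.
Hypotheses (e0 : e 0 = 0) (e1 : e 1 = 1).
Local Notation R := (rel_of L (e 2)).
Local Notation A := (arc_of L (e 3)).

Lemma sat_rel d a b c : 3 < d -> a < d -> b < d -> c < d ->
  sat e (FRel d a b c) = R (e a) (e b) (e c).
Proof.
move=> d3 ad bd cd; have LN := size_items_le.
rewrite sat_ex //; apply/hasP/hasP => -[r]; rewrite mem_iota => rN.
  do 6![letadd; rewrite ?e1; case/andP=> _].
  rewrite !sat_and !sat_item; upds; rewrite ?e0 //; [|lia ..] => H.
  exists r; last by move: H; rewrite !(mulnDl, mulSn, mul0n) !addnA; congr [&& item _ _ _, item _ _ _ & item _ _ _]; lia.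
  by rewrite mem_iota; case/and3P: H => _ _ /andP[]; lia.
move=> H; exists r; first by rewrite mem_iota; lia.
(* The largest index lies in a list of at most [N] entries, so none of the sums overflows. *)
have lt : e 2 + 3 * r + 3 < size L by case/and3P: H => _ _ /andP[].
do 6![letadd; rewrite ?e1; apply/andP; split; first lia].
rewrite !sat_and !sat_item; upds; rewrite ?e0 //; [|lia ..].
by move: H; congr [&& item _ _ _, item _ _ _ & item _ _ _]; lia.
Qed.

Lemma sat_arc d i u v : 3 < d -> u < d -> v < d -> sat e (FArc d i u v) = A i (e u) (e v).
Proof.
move=> d3 ud vd; have LN := size_items_le.
rewrite sat_and sat_lt /arc_of; congr andb.
do 2!letadd; rewrite ?e1.
case: i.
  letadd; rewrite ?e1.
  rewrite sat_item; upds; rewrite ?e0 //; [|lia ..].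
  rewrite /item (_ : nat_of_bool true = 1) //.
  by case: (_ == e v); rewrite ?andbT ?andbF //; lia.
rewrite sat_item; upds; rewrite ?e0 //; [|lia ..].
by rewrite /item addn0; case: (_ == e v); rewrite ?andbT ?andbF //; lia.
Qed.

End Env.

Definition arc_bits l q n i v b := count (fun u => arc_of l n i u v && rel_of l q u b 0) (iota 0 N).

(** The formula also asserts that every intermediate sum is below [N], so the converse direction
    needs size bounds. *)
Lemma sat_column e d v b : e 0 = 0 -> e 1 = 1 -> 3 < d -> v < d -> b < d ->
  let C := carry_of N (rel_of L (e 2)) (e v) in
  let B i := arc_bits L (e 2) (e 3) i (e v) (e b).+1 in
  (sat e (FColumn d v b) -> C (e b) + B false + B true = rel_of L (e 2) (e v) (e b) 0 + (C (e b).+1).*2) /\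
  (C (e b) + B false + B true = rel_of L (e 2) (e v) (e b) 0 + (C (e b).+1).*2 ->
   (e b).+1 < N -> C (e b) + B false + B true < N -> (C (e b).+1).*2.+1 < N -> sat e (FColumn d v b)).
Proof.
move=> e0 e1 d3 vd bd C B.
have E : sat e (FColumn d v b) = [&& (e b).+1 < N, C (e b) < N, B false < N, B true < N, C (e b).+1 < N,
    C (e b) + B false < N, C (e b) + B false + B true < N, C (e b).+1 + C (e b).+1 < N, C (e b).+1 + C (e b).+1 + 1 < N
    & C (e b) + B false + B true == rel_of L (e 2) (e v) (e b) 0 + (C (e b).+1).*2].
  letadd; rewrite e1 addn1; congr andb.
  rewrite (@sat_letcnt _ _ _ _ _ (fun c => (0 < c) && rel_of L (e 2) (e v) (e b) c)); [|by upds|]; last first.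
    by move=> c k _; rewrite sat_and sat_lt sat_rel; upds; rewrite ?e0 ?e1 //; lia.
  congr andb.
  rewrite (@sat_letcnt _ _ _ _ _ (fun u => arc_of L (e 3) false u (e v) && rel_of L (e 2) u (e b).+1 0)); [|by upds|]; last first.
    by move=> c k _; rewrite sat_and sat_arc ?sat_rel; upds; rewrite ?e0 ?e1 //; lia.
  congr andb.
  rewrite (@sat_letcnt _ _ _ _ _ (fun u => arc_of L (e 3) true u (e v) && rel_of L (e 2) u (e b).+1 0)); [|by upds|]; last first.
    by move=> c k _; rewrite sat_and sat_arc ?sat_rel; upds; rewrite ?e0 ?e1 //; lia.
  congr andb.
  rewrite (@sat_letcnt _ _ _ _ _ (fun c => (0 < c) && rel_of L (e 2) (e v) (e b).+1 c)); [|by upds|]; last first.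
    by move=> c k _; rewrite sat_and sat_lt sat_rel; upds; rewrite ?e0 ?e1 //; lia.
  congr andb.
  do 4!letadd; rewrite e1 -/(C (e b)) -/(C (e b).+1) -/(B true) -/(B false); do 4 congr andb.
  rewrite sat_or 2!sat_and sat_not !sat_eq !sat_rel; upds; rewrite ?e0 ?e1 //; try lia.
  rewrite -/(carry_of N (rel_of L (e 2)) (e v) (e b)) -/(carry_of N (rel_of L (e 2)) (e v) (e b).+1).
  rewrite -/(arc_bits L (e 2) (e 3) true (e v) (e b).+1) -/(arc_bits L (e 2) (e 3) false (e v) (e b).+1) -/(C (e b)) -/(C (e b).+1) -/(B true) -/(B false).
  move: (C (e b)) (C (e b).+1) (B true) (B false) => c1 c2 b1 b2.
  by case: (rel_of L (e 2) (e v) (e b) 0); rewrite /= ?orbF -addnn; lia.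
rewrite E; move: (C (e b)) (C (e b).+1) (B true) (B false) => c1 c2 b1 b2 {E}.
by split; lia.
Qed.
End CertificateFormula.

Definition FIn d v := FRel d 3 v 0.

(* In FValid and FCertificate the variables 1, ..., 7 stand for the number 1, the index q
   of the block ended by the separator #, n, the indices of d and o, d and o. *)
Definition FCertificate :=
  FAnd (FAll 8 (FAll 9 (FImp (FAnd (FIn 10 8) (FOr (FArc 10 false 8 9) (FArc 10 true 8 9))) (FIn 10 9))))
  (FAnd (FNot (FIn 8 6))
  (FAnd (FAll 8 (FNot (FRel 9 6 8 0)))
  (FAll 8 (FImp (FAnd (FLt 8 3) (FNot (FIn 9 8)))
    (FAnd (FLetCnt 9 (FCarry 10 8 0)
             (FCnt 10 (FOr (FArcBit 10 false 8 0) (FAnd (FEq 10 3) (FEq 8 7))) 9))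
    (FAnd (FAll 9 (FImp (FLt 9 3) (FColumn 10 8 9)))
          (FAll 9 (FNot (FCarry 9 8 3))))))))).

(** Item [q] being 0 says that [x] ends with a complete number code; the last conjunct bounds all
    entries after the first by [n]. *)
Definition FValid :=
  FAnd (FAnd (FLt 0 1) (FNot (FEx 8 (FAnd (FLt 0 8) (FLt 8 1)))))
  (FAnd (FEx 8 (FAnd (FLetter 8 (Some None)) (FEnds 9 8 2)))
  (FAnd (FLetAdd 8 3 3 (FAnd (FAdd 9 8 1 5) (FAnd (FAdd 9 5 1 4) (FAdd 9 4 1 2))))
  (FAnd (FAnd (FItem 8 2 0) (FAnd (FItem 8 0 3) (FAnd (FItem 8 4 6) (FItem 8 5 7))))
        (FAll 8 (FImp (FAnd (FLt 0 8) (FLt 8 2)) (FEx 9 (FAnd (FLt 9 3) (FItem 10 8 9)))))))).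

(** The parameters are quantified universally, so a word that encodes no instance, and hence lies in
    the complement, satisfies this vacuously. *)
Definition FMain :=
  FAll 1 (FAll 2 (FAll 3 (FAll 4 (FAll 5 (FAll 6 (FAll 7 (FImp FValid FCertificate))))))).

Lemma scoped_main : scoped 1 FMain.
Proof. by vm_compute. Qed.

Section FormulaSemantics.
Variable w : word.
Local Notation N := (size w).
Local Notation sat := (sat w).
Local Notation L := (items 0 w).
Local Notation I := (iota 0 N).

Lemma sat_all_eq e v f (P : pred nat) : e 0 = 0 ->
  (forall k, k < N -> sat (upd e v k) f = P k) -> sat e (FAll v f) = all P I.
Proof. by move=> e0 fP; rewrite sat_all //; apply: eq_in_all => k; rewrite mem_iota => /fP. Qed.

Lemma sat_certificate e : e 0 = 0 -> e 1 = 1 ->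
  let R := rel_of L (e 2) in
  let A := arc_of L (e 3) in
  sat e FCertificate = [&&
    all (fun u => all (fun v => R (e 3) u 0 && (A false u v || A true u v) ==> R (e 3) v 0) I) I,
    ~~ R (e 3) (e 6) 0,
    all (fun b => ~~ R (e 6) b 0) I &
    all (fun v => (v < e 3) && ~~ R (e 3) v 0 ==>
      [&& (carry_of N R v 0 < N) && (count (fun u => A false u v && R u 0 0 || (u == e 3) && (v == e 7)) I == carry_of N R v 0),
        all (fun b => (b < e 3) ==> sat (upd (upd e 8 v) 9 b) (FColumn 10 8 9)) I &
        all (fun c => ~~ ((0 < c) && R v (e 3) c)) I]) I].
Proof.
move=> e0 e1 R A.
have relE e' d a b c : e' 0 = 0 -> e' 1 = 1 -> e' 2 = e 2 -> 3 < d -> a < d -> b < d -> c < d ->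
    sat e' (FRel d a b c) = R (e' a) (e' b) (e' c).
  by move=> *; rewrite sat_rel // /R; congr (rel_of _ _ _ _ _).
have arcE e' d i u v : e' 0 = 0 -> e' 1 = 1 -> e' 3 = e 3 -> 3 < d -> u < d -> v < d ->
    sat e' (FArc d i u v) = A i (e' u) (e' v).
  by move=> *; rewrite sat_arc // /A; congr (arc_of _ _ _ _ _).
rewrite 3!sat_and; congr [&& _, _, _ & _].
- apply: sat_all_eq => // u _; apply: sat_all_eq => [|v _]; first by upds.
  by rewrite sat_imp sat_and sat_or !relE ?arcE; upds; rewrite ?e0.
- by rewrite sat_not relE ?e0.
- by apply: sat_all_eq => // b _; rewrite sat_not relE; upds; rewrite ?e0.
apply: sat_all_eq => // v _; rewrite sat_imp 3!sat_and sat_lt sat_not relE; upds => //; rewrite ?e0.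
congr (_ ==> [&& _, _ & _]).
- rewrite (@sat_letcnt _ _ _ _ _ (fun c => (0 < c) && R v 0 c)); [|by upds|]; last first.
    by move=> c k _; rewrite sat_and sat_lt relE; upds; rewrite ?e0.
  congr andb; rewrite (@sat_cnt _ _ _ _ _ (fun u => A false u v && R u 0 0 || (u == e 3) && (v == e 7))).
    by upds.
  by move=> u _; rewrite sat_or 2!sat_and !sat_eq relE ?arcE; upds; rewrite ?e0.
- apply: sat_all_eq => [|b _]; first by upds.
  by rewrite sat_imp sat_lt; upds.
apply: sat_all_eq => [|c _]; first by upds.
by rewrite sat_not sat_and sat_lt relE; upds; rewrite ?e0.
Qed.

Lemma sat_and5 e f1 f2 f3 f4 f5 : sat e (FAnd f1 (FAnd f2 (FAnd f3 (FAnd f4 f5)))) =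
  [&& sat e f1, sat e f2, sat e f3, sat e f4 & sat e f5].
Proof. by []. Qed.

Lemma sat_valid e : e 0 = 0 -> 0 < N -> (forall i, i < 8 -> e i < N) ->
  sat e FValid = [&& e 1 == 1,
    has (fun p => (nth None w p == None) && (size (items 0 (take p w)) == e 2)) I,
    [&& e 3 + e 3 < N, e 3 + e 3 + e 1 == e 5, e 5 + e 1 == e 4 & e 4 + e 1 == e 2],
    [&& item L (e 2) 0, item L 0 (e 3), item L (e 4) (e 6) & item L (e 5) (e 7)] &
    all (fun k => (0 < k) && (k < e 2) ==> has (fun a => (a < e 3) && item L k a) I) I].
Proof.
move=> e0 N0 eN.
rewrite sat_and5; congr [&& _, _, _, _ & _].
- rewrite sat_and sat_lt sat_not sat_ex // e0.
  apply/andP/eqP => [[e1 /hasPn H]|e1]; last first.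
    by split; rewrite ?e1 //; apply/hasPn => k _; rewrite sat_and !sat_lt; upds; rewrite e0 e1; lia.
  apply/eqP; rewrite eqn_leq e1 andbT leqNgt; apply/negP => lt.
  have /H : 1 \in I by rewrite mem_iota; have := eN 1 isT; lia.
  by rewrite sat_and !sat_lt; upds; rewrite e0 lt.
- rewrite sat_ex //; apply: eq_in_has => p; rewrite mem_iota => /= pN.
  rewrite -!/(sat _ _) -/(FEnds 9 8 2).
  rewrite -[LHS]/(sat (upd e 8 p) (FLetter 8 (Some None)) && sat (upd e 8 p) (FEnds 9 8 2)).
  rewrite sat_ends ?upd_eq ?(ltnW pN) // [X in X && _]/= upd_eq /letter_at (nth_map None) //.
- letadd; congr andb; rewrite 2!sat_and !sat_add; upds => //; by rewrite ltnW // eN.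
- by rewrite 3!sat_and !sat_item // e0.
- apply: sat_all_eq => // k _; rewrite sat_imp sat_and !sat_lt sat_ex; upds; rewrite ?e0 //.
  congr (_ ==> _); apply: eq_has => a; rewrite sat_and sat_lt sat_item; upds => //.
Qed.
End FormulaSemantics.

(** * Encoding of instances *)

Definition enc_seq (l : seq nat) : seq bool := flatten (map enc_nat l).

Lemma items_enc_nat acc m r : items acc (map Some (enc_nat m) ++ r) = acc + m :: items 0 r.
Proof. by elim: m acc => [|m IH] acc /=; rewrite ?addn0 // IH addSnnS. Qed.

Lemma items_enc_seq l r : items 0 (map Some (enc_seq l) ++ r) = l ++ items 0 r.
Proof. by elim: l => //= a l IH; rewrite map_cat -catA items_enc_nat IH. Qed.

Lemma tail_enc_nat acc m : tail acc (map Some (enc_nat m)) = 0.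
Proof. by elim: m acc => //= m IH acc. Qed.

Lemma tail_enc_seq l : tail 0 (map Some (enc_seq l)) = 0.
Proof. by elim: l => //= a l IH; rewrite map_cat /tail foldl_cat -/(tail 0 _) tail_enc_nat. Qed.

(** Every bit word is a list of number codes followed by an unfinished block, so being an encoding
    is a condition on [items] and [tail] alone. *)
Lemma enc_seq_items acc x :
  nseq acc true ++ x = enc_seq (items acc (map Some x)) ++ nseq (tail acc (map Some x)) true.
Proof.
elim: x acc => [|[] x IH] acc /=; first by rewrite cats0.
  by rewrite -IH /=; elim: acc => //= a ->.
by rewrite /enc_seq /= -catA -(IH 0) /enc_nat -catA.
Qed.

Lemma size_enc_seq l : size (enc_seq l) = sumn l + size l.
Proof. by elim: l => //= a l IH; rewrite size_cat IH size_cat size_nseq /=; lia. Qed.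

Lemma size_flatten_const T k (ss : seq (seq T)) :
  all (fun s => size s == k) ss -> size (flatten ss) = k * size ss.
Proof. by elim: ss => //= [|s ss IH]; rewrite ?muln0 // => /andP[/eqP ks /IH E]; rewrite size_cat ks E mulnS. Qed.

Lemma nth_flatten_const T (x0 : T) k (ss : seq (seq T)) i j :
  all (fun s => size s == k) ss -> i < size ss -> j < k ->
  nth x0 (flatten ss) (k * i + j) = nth x0 (nth [::] ss i) j.
Proof.
elim: ss i => // s ss IH i /= /andP[/eqP ks all_ss] + jk; rewrite nth_cat ks.
case: i => [|i] iss; first by rewrite muln0 jk.
by rewrite mulnS -addnA ltnNge leq_addr /= addKn IH.
Qed.

Definition instance_list n (s0 s1 : 'I_n -> 'I_n) (o d : 'I_n) : seq nat :=
  n :: flatten [seq [:: val (s0 v); val (s1 v)] | v <- enum 'I_n] ++ [:: val o; val d].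

Section InstanceList.
Variables (n : nat) (s0 s1 : 'I_n -> 'I_n) (o d : 'I_n).
Local Notation l := (instance_list s0 s1 o d).

Lemma enc_instanceE : enc_instance s0 s1 o d = enc_seq l.
Proof.
rewrite /enc_instance /enc_seq /= map_cat flatten_cat /= cats0; congr (_ ++ (_ ++ _)).
by elim: (enum _) => //= v s ->; rewrite catA.
Qed.

Lemma size_succ_lists : size (flatten [seq [:: val (s0 v); val (s1 v)] | v <- enum 'I_n]) = 2 * n.
Proof.
rewrite (@size_flatten_const _ 2); last by rewrite all_map; apply/allP.
by rewrite size_map size_enum_ord.
Qed.

Lemma size_instance_list : size l = n.*2 + 3.
Proof. by rewrite /= size_cat size_succ_lists /=; lia. Qed.

Lemma nth_instance_s (i : bool) (v : 'I_n) : nth 0 l (v + v + 1 + i) = if i then s1 v else s0 v.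
Proof.
have -> : v + v + 1 + i = (2 * v + i).+1 by lia.
rewrite /= nth_cat size_succ_lists.
have -> : 2 * v + i < 2 * n by have := ltn_ord v; case: i; lia.
rewrite (@nth_flatten_const _ _ 2); [|by rewrite all_map; apply/allP|by rewrite size_map size_enum_ord|by case: i].
by rewrite (nth_map v) ?size_enum_ord // nth_ord_enum; case: i.
Qed.

Lemma nth_instance_o : nth 0 l (n.*2 + 1) = o.
Proof. by rewrite addn1 /= nth_cat size_succ_lists mul2n ltnn subnn. Qed.

Lemma nth_instance_d : nth 0 l (n.*2 + 2) = d.
Proof. by rewrite addn2 /= nth_cat size_succ_lists mul2n ltnNge leqnSn /= subSnn. Qed.

Lemma instance_list_lt k : 0 < k -> k < n.*2 + 3 -> nth 0 l k < n.
Proof.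
case: k => // k _; rewrite -size_instance_list [size _]/= [nth _ _ _]/= ltnS => /(mem_nth 0); rewrite mem_cat => /orP[|].
  by move=> /flattenP[s /mapP[v _ ->]]; rewrite !inE => /orP[] /eqP ->.
by rewrite !inE => /orP[] /eqP ->.
Qed.

End InstanceList.

Definition is_instance x :=
  let l := items 0 (map Some x) in
  [&& tail 0 (map Some x) == 0, size l == (nth 0 l 0).*2 + 3 & all (fun a => a < nth 0 l 0) (behead l)].

Lemma is_instanceP x : is_instance x ->
  exists n (s0 s1 : 'I_n -> 'I_n) (o d : 'I_n), x = enc_instance s0 s1 o d.
Proof.
rewrite /is_instance; have := enc_seq_items 0 x; move: (items _ _) => l.
move=> xE /and3P[/eqP t0 /eqP sl /allP lt]; rewrite t0 cats0 /= in xE.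
case: l => [|n l] //= in xE sl lt *.
(* For [n = 0] the two remaining entries would have to be below 0; a positive [n] makes [inord]
   available. *)
case: n => [|n] in xE sl lt *; first by case: l xE sl lt => // a l _ _ /(_ a); rewrite inE eqxx => /(_ isT).
have val_inord k : k < size l -> val (inord (nth 0 l k) : 'I_n.+1) = nth 0 l k.
  by move=> kl; rewrite /= inordK // lt // mem_nth.
exists n.+1, (fun v => inord (nth 0 l (2 * v))), (fun v => inord (nth 0 l (2 * v + 1))),
  (inord (nth 0 l (2 * n.+1))), (inord (nth 0 l (2 * n.+1 + 1))).
rewrite enc_instanceE xE; congr enc_seq.
set l' := instance_list _ _ _ _; apply: (@eq_from_nth _ 0).
  by rewrite size_instance_list /= sl.
move=> [|k] //= kl; rewrite nth_cat size_succ_lists.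
case: ltnP => kn; last first.
  have [->|->] : k = 2 * n.+1 \/ k = 2 * n.+1 + 1 by lia.
    by rewrite subnn; apply/esym/val_inord; lia.
  by rewrite addKn; apply/esym/val_inord; lia.
have kE : k = 2 * k./2 + odd k by rewrite addnC mul2n odd_double_half.
have k2 : k./2 < n.+1 by lia.
rewrite [in RHS]kE (@nth_flatten_const _ _ 2); [|by rewrite all_map; apply/allP|by rewrite size_map size_enum_ord|by case: (odd k)].
rewrite (nth_map (Ordinal k2)) ?size_enum_ord // (nth_ord_enum (Ordinal k2) (Ordinal k2)) [in LHS]kE.
by case: (odd k) kE => kE; rewrite ?addn0; apply/esym/val_inord => /=; lia.
Qed.

Lemma items_input x u : items 0 (input_word x u) =
  items 0 (map Some x) ++ tail 0 (map Some x) :: items 0 (map Some u).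
Proof. by rewrite /input_word items_cat. Qed.

(** Neither [x] nor [u] contains the symbol [None], so the separator is unique. *)
Lemma has_separator x u q :
  has (fun p => (nth None (input_word x u) p == None) && (size (items 0 (take p (input_word x u))) == q))
    (iota 0 (size (input_word x u))) = (size (items 0 (map Some x)) == q).
Proof.
have Ex : take (size x) (input_word x u) = map Some x by rewrite take_size_cat ?size_map.
apply/hasP/idP => [[p]|qE].
  rewrite mem_iota size_cat /= => pN /andP[]; rewrite nth_cat size_map.
  have [px|] := ltnP p (size x); first by rewrite (nth_map false).
  rewrite leq_eqVlt => /orP[/eqP <-|px]; first by rewrite Ex.
  have -> : p - size x = (p - (size x).+1).+1 by lia.
  by rewrite /= (nth_map false) //; move: pN; rewrite !size_map; lia.
exists (size x); last by rewrite Ex qE nth_cat size_map ltnn subnn.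
by rewrite mem_iota size_cat !size_map /=; lia.
Qed.

(** Position [n] is no vertex number, so the second disjunct can add a truth value to the count; it
    serves for [o == v]. *)
Lemma count_iota_ord n N (P : nat -> bool) (b : bool) : n < N ->
  count (fun u => (u < n) && P u || (u == n) && b) (iota 0 N) = b + \sum_(u < n) P u.
Proof.
move=> nN; have -> : N = n + 1 + (N - n.+1) by lia.
rewrite !iotaD !count_cat /= add0n ltnn eqxx addn0 /= [X in _ + X](_ : _ = 0); last first.
  by apply/eqP; rewrite -leqn0 leqNgt -has_count; apply/hasPn => q; rewrite mem_iota; lia.
rewrite addn0 addnC; congr addn; rewrite -(big_mkord xpredT (fun u => P u : nat)) -sumn_count sumnE big_map.
by rewrite /index_iota subn0; apply: eq_big_seq => q; rewrite mem_iota => /= qn; rewrite qn (ltn_eqF qn) orbF.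
Qed.

(** * The certificate formula on an encoded instance *)

Section Instance.
Variables (n : nat) (s0 s1 : 'I_n -> 'I_n) (o d : 'I_n) (u : seq bool).
Local Notation l := (instance_list s0 s1 o d).
Local Notation q := (n.*2 + 3).
Let w := input_word (enc_instance s0 s1 o d) u.
Local Notation N := (size w).
Local Notation L := (items 0 w).
Local Notation R := (rel_of L q).

Lemma items_instance : L = l ++ 0 :: items 0 (map Some u).
Proof. by rewrite items_input enc_instanceE -(cats0 (map Some (enc_seq l))) items_enc_seq cats0 cats0 tail_enc_seq. Qed.

Lemma instance_size : q < N.
Proof. by rewrite size_cat /= !size_map enc_instanceE size_enc_seq size_instance_list; lia. Qed.

Lemma item_instance k a : k < q -> item L k a = (nth 0 l k == a).
Proof.
move=> kq; rewrite /item items_instance nth_cat size_cat size_instance_list kq.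
by rewrite (_ : k < _) //; lia.
Qed.

Lemma arc_instance i (v : 'I_n) y : arc_of L n i v y = ((if i then s1 v else s0 v) == y :> nat).
Proof.
rewrite /arc_of ltn_ord item_instance; last by have := ltn_ord v; case: i; lia.
by rewrite nth_instance_s; case: i.
Qed.

Lemma count_arcs i (v : 'I_n) (P : nat -> bool) (b : bool) :
  count (fun y => arc_of L n i y v && P y || (y == n) && b) (iota 0 N) =
  b + \sum_y (((if i then s1 y else s0 y) == v) && P y).
Proof.
rewrite (eq_count (a2 := fun y => (y < n) && (arc_of L n i y v && P y) || (y == n) && b)); last first.
  by move=> y; rewrite /arc_of; case: (y < n).
rewrite count_iota_ord; last by have := instance_size; lia.
by congr addn; apply: eq_bigr => y _; rewrite arc_instance; case: i.
Qed.

Lemma arc_bits_instance i (v : 'I_n) b :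
  arc_bits w L q n i v b = \sum_y (((if i then s1 y else s0 y) == v) && R y b 0).
Proof.
have := @count_arcs i v (fun y => R y b 0) false; rewrite add0n => <-.
by apply: eq_count => y; rewrite andbF orbF.
Qed.

Section Env.
Variable e : nat -> nat.
Hypotheses (e0 : e 0 = 0) (e1 : e 1 = 1) (e2 : e 2 = q) (e3 : e 3 = n) (e6 : e 6 = d) (e7 : e 7 = o).

Lemma certificate_sound : sat w e FCertificate -> bincert s0 s1 o d N R.
Proof.
have nN : n < N by have := instance_size; lia.
have vN (v : 'I_n) : (v : nat) \in iota 0 N by rewrite mem_iota /= add0n (ltn_trans _ nN).
rewrite sat_certificate // e2 e3 e6 e7 => /and4P[/allP c1 c2 /allP c3 /allP c4].
split=> [v Rv||b bN|v Rv|v Rv b bn|v Rv] //.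
- have c i : R n (if i then s1 v else s0 v) 0.
    have /allP/(_ _ (vN (if i then s1 v else s0 v))) := c1 _ (vN v).
    by rewrite Rv !arc_instance; case: (i); rewrite eqxx ?orbT.
  by rewrite (c false) (c true).
- by apply: c3; rewrite mem_iota.
- have := c4 _ (vN v); rewrite ltn_ord Rv => /and3P[/andP[_ /eqP <-] _ _].
  rewrite (@count_arcs false v (fun y => R y 0 0)); congr (_ + _).
  by rewrite -val_eqE eq_sym.
- have bI : b \in iota 0 N by rewrite mem_iota; lia.
  have := c4 _ (vN v); rewrite ltn_ord Rv => /and3P[_ /allP/(_ b bI)/implyP/(_ bn) col _].
  have [+ _] := @sat_column w (upd (upd e 8 v) 9 b) 10 8 9 e0 e1 isT isT isT.
  by upds; rewrite e2 e3 !arc_bits_instance => /(_ col).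
have := c4 _ (vN v); rewrite ltn_ord Rv => /and3P[_ _ /allP c].
apply/eqP; rewrite -leqn0 leqNgt -has_count; apply/hasPn => y /c; done.
Qed.

(** Column sums are at most [5 * n + 1] and doubled carries plus one at most [6 * n + 3], so the
    assumed length of the word prevents overflow. *)
Lemma certificate_complete R' : (forall a b c, R' a b c = R a b c) ->
  bincert s0 s1 o d N R' -> (forall v b, carry_of N R' v b <= 3 * n + 1) -> 8 * n + 8 < N ->
  sat w e FCertificate.
Proof.
move=> RR cert carry_le nN.
have carryE v b : carry_of N R v b = carry_of N R' v b by apply: eq_count => c; rewrite RR.
rewrite sat_certificate // e2 e3 e6 e7; apply/and4P; split.
- apply/allP => y _; apply/allP => z _; apply/implyP => /andP[Ry arc].
  have yn : y < n by case/orP: arc => /andP[].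
  have := bincert_closed cert (u := Ordinal yn); rewrite RR => /(_ Ry)/andP[R0 R1].
  case/orP: arc; rewrite -[y]/(nat_of_ord (Ordinal yn)) arc_instance => /eqP <-; by rewrite -RR.
- by rewrite -RR; apply: bincert_target cert.
- by apply/allP => b; rewrite mem_iota -RR => bN; apply: bincert_zero cert _ _.
apply/allP => y _; apply/implyP => /andP[yn]; rewrite -RR -[y]/(nat_of_ord (Ordinal yn)) => Ry.
move: (Ordinal yn) Ry => v Rv {y yn}; apply/and3P; split.
- apply/andP; split; first by rewrite carryE; have := carry_le v 0; lia.
  rewrite (@count_arcs false v (fun y => R y 0 0)) carryE (bincert_init cert Rv).
  apply/eqP; congr (_ + _); first by rewrite -val_eqE eq_sym.
  by apply: eq_bigr => y _; rewrite RR.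
- apply/allP => b _; apply/implyP => bn.
  have [_] := @sat_column w (upd (upd e 8 v) 9 b) 10 8 9 e0 e1 isT isT isT.
  upds; rewrite e2 e3 !arc_bits_instance !carryE => col.
  have sum_le (F : 'I_n -> bool) : \sum_y F y <= n.
    by rewrite -[X in _ <= X]card_ord -sum1_card; apply: leq_sum => y _; case: (F y).
  apply: col; first 1 last.
  + by lia.
  + have := sum_le (fun y => (s0 y == v) && R y b.+1 0).
    have := sum_le (fun y => (s1 y == v) && R y b.+1 0).
    by have := carry_le v b; lia.
  + by have := carry_le v b.+1; lia.
  have := bincert_column cert Rv bn; rewrite -RR => <-.
  by congr (_ + _ + _); apply: eq_bigr => y _; rewrite RR.
apply/allP => c cN; have /eqP := bincert_top cert Rv.
by rewrite -leqn0 leqNgt -has_count -RR => /hasPn/(_ c cN).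
Qed.

End Env.
End Instance.

(** * Correctness of the formula *)

Lemma sat_main_elim w a1 a2 a3 a4 a5 a6 a7 : sat w (fun=> 0) FMain ->
  [/\ a1 < size w, a2 < size w, a3 < size w & a4 < size w] ->
  [/\ a5 < size w, a6 < size w & a7 < size w] ->
  sat w (upd (upd (upd (upd (upd (upd (upd (fun=> 0) 1 a1) 2 a2) 3 a3) 4 a4) 5 a5) 6 a6) 7 a7)
    (FImp FValid FCertificate).
Proof.
move=> H [l1 l2 l3 l4] [l5 l6 l7].
have allE e v f a : e 0 = 0 -> a < size w -> sat w e (FAll v f) -> sat w (upd e v a) f.
  by move=> e0 aN /(sat_allP _ _ _ e0)/(_ a aN).
by do 7!(apply: (allE); [by [] | by [] |]).
Qed.

Lemma sat_main_intro w :
  (forall e, e 0 = 0 -> (forall i, i < 8 -> e i < size w) -> sat w e FValid -> sat w e FCertificate) ->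
  0 < size w -> sat w (fun=> 0) FMain.
Proof.
move=> H N0.
have allI e v f : e 0 = 0 -> (forall a, a < size w -> sat w (upd e v a) f) -> sat w e (FAll v f).
  by move=> e0 aN; apply/sat_allP.
do 7![apply: (allI) => // ? ?].
rewrite sat_imp; apply/implyP; apply: H => // -[|[|[|[|[|[|[|[]]]]]]]] //.
Qed.

Lemma main_sound x u : sat (input_word x u) (fun=> 0) FMain -> ~ arrival_lang x.
Proof.
move=> H [n [s0 [s1 [o [d [xE]]]]]]; rewrite xE in H.
have szN := instance_size s0 s1 o d u; have onN := ltn_ord o; have dN := ltn_ord d.
set w := input_word _ _ in H szN; set q := n.*2 + 3 in szN.
(* The universal quantifiers are instantiated with the true parameters of the encoding. *)
pose e := upd (upd (upd (upd (upd (upd (upd (fun=> 0) 1 1) 2 q) 3 n) 4 (n.*2 + 2)) 5 (n.*2 + 1)) 6 d) 7 o.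
have imp : sat w e (FImp FValid FCertificate) by apply: sat_main_elim => //; split; lia.
have eN i : i < 8 -> e i < size w by move: i => [|[|[|[|[|[|[|[]]]]]]]] // _; rewrite /e /upd /=; lia.
have valid : sat w e FValid.
  rewrite sat_valid //; last lia.
  rewrite has_separator enc_instanceE -[X in items 0 X](cats0 (map Some _)) items_enc_seq cats0 size_instance_list.
  have itemE k a : k < q -> item (items 0 w) k a = (nth 0 (instance_list s0 s1 o d) k == a) by apply: item_instance.
  have itemq : item (items 0 w) q 0.
    by rewrite /item /w items_instance size_cat nth_cat size_instance_list ltnn subnn /= andbT -/q; lia.
  have [-> -> -> ->] : [/\ e 1 = 1, e 2 = q, e 3 = n & e 4 = n.*2 + 2] by [].
  have [-> -> ->] : [/\ e 5 = n.*2 + 1, e 6 = d & e 7 = o] by [].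
  rewrite eqxx; apply/and5P; split=> //.
  - by apply/and4P; split; lia.
  - rewrite itemq !itemE; try (by rewrite /q; lia).
    by rewrite nth_instance_o nth_instance_d !eqxx.
  apply/allP => k _; apply/implyP => /andP[k0 kq]; apply/hasP; exists (nth 0 (instance_list s0 s1 o d) k).
    by rewrite mem_iota; have := instance_list_lt s0 s1 o d k0 kq; lia.
  by rewrite itemE // eqxx andbT instance_list_lt.
move: imp; rewrite sat_imp valid => /(certificate_sound (s0 := s0) (s1 := s1) (o := o) (d := d)) cert.
apply: (bincert_sound (N := size w) (R := rel_of (items 0 w) q)); first lia.
by apply: cert.
Qed.

Lemma valid_is_instance x u e : let w := input_word x u in
  e 0 = 0 -> (forall i, i < 8 -> e i < size w) -> sat w e FValid -> is_instance x.
Proof.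
move=> w e0 eN; have N0 : 0 < size w by rewrite size_cat /= addnS.
rewrite sat_valid // has_separator => /and5P[/eqP e1 /eqP e2 /and4P[_ /eqP e5 /eqP e4 /eqP eq] /and4P[t0 n0 _ _] /allP lt].
have itemE k : k < e 2 -> forall a, item (items 0 w) k a = (nth 0 (items 0 (map Some x)) k == a).
  move=> kq a; rewrite /item items_input nth_cat e2 kq size_cat /= e2.
  by rewrite (_ : k < _) //; lia.
rewrite /is_instance; apply/and3P; split.
- by move: t0; rewrite /item items_input nth_cat e2 ltnn subnn => /andP[].
- move: n0; rewrite itemE; last by lia.
  by rewrite e2 => /eqP ->; lia.
move: n0; rewrite itemE; last by lia.
move=> /eqP ->; apply/(all_nthP 0) => k; rewrite size_behead nth_behead e2 => kq.
have /lt : k.+1 \in iota 0 (size w) by rewrite mem_iota; have := eN 2 isT; lia.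
have -> /= : (0 < k.+1) && (k.+1 < e 2) by lia.
case/hasP => a _ /andP[an]; rewrite itemE; last by lia.
by move=> /eqP ->.
Qed.

Definition triples (n : nat) (R : nat -> nat -> nat -> bool) : seq (seq nat) :=
  [seq t <- [seq [:: ab.1; ab.2; c] | ab <- [seq (a, b) | a <- iota 0 n.+1, b <- iota 0 n.+1], c <- iota 0 (3 * n + 2)]
    | R (nth 0 t 0) (nth 0 t 1) (nth 0 t 2)].

Lemma mem_triples n R a b c : ([:: a; b; c] \in triples n R) =
  [&& R a b c, a <= n, b <= n & c < 3 * n + 2].
Proof.
rewrite mem_filter; congr andb; apply/allpairsPdep/and3P => [[[a' b'] [c' [ab c3 [-> -> ->]]]]|[an bn c3]].
  by move: ab c3 => /allpairsPdep[a1 [b1 [+ + [-> ->]]]]; rewrite !mem_iota => *; split; lia.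
exists (a, b), c; split; rewrite ?mem_iota //.
by apply/allpairsPdep; exists a, b; rewrite !mem_iota.
Qed.

Lemma triples_spec n R t : t \in triples n R -> [/\ size t = 3 & sumn t <= 5 * n + 1].
Proof.
rewrite mem_filter => /andP[_ /allpairsPdep[[a b] [c [/allpairsPdep[a1 [b1 [+ + [-> ->]]]] + ->]]]].
by rewrite !mem_iota => *; split=> //=; lia.
Qed.

Lemma size_triples n R : size (triples n R) <= n.+1 * n.+1 * (3 * n + 2).
Proof. by rewrite size_filter (leq_trans (count_size _ _)) // !size_allpairs !size_iota. Qed.

(** The entry 0 at index [size l] is the empty block ended by the separator, so triples start right
    after it; their constant length 3 fixes the division. *)
Lemma rel_of_triples l n (R : nat -> nat -> nat -> bool) a b c :
  (forall a b c, R a b c -> [/\ a <= n, b <= n & c <= 3 * n + 1]) ->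
  rel_of (l ++ 0 :: flatten (triples n R)) (size l) a b c = R a b c.
Proof.
move=> Rb; set T := triples n R.
have T3 : all (fun t => size t == 3) T by apply/allP => t /triples_spec[/eqP].
have itemE r j y : j < 3 -> item (l ++ 0 :: flatten T) (size l + 3 * r + j.+1) y =
    (r < size T) && (nth 0 (nth [::] T r) j == y).
  move=> j3; rewrite /item size_cat /= (size_flatten_const T3) nth_cat.
  have -> : (size l + 3 * r + j.+1 < size l) = false by lia.
  rewrite -addnA addKn addnS /=.
  case: ltnP => rT; last by rewrite (_ : _ < _ = false) //; lia.
  by rewrite nth_flatten_const // (_ : _ < _ = true) //; lia.
have : ([:: a; b; c] \in T) = R a b c.
  rewrite mem_triples; case: (boolP (R a b c)) => // /Rb[-> ->] /= cn; lia.
move=> <-; apply/hasP/idP => [[r _]|abc].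
  rewrite !itemE // => /and3P[/andP[rT /eqP <-] /andP[_ /eqP <-] /andP[_ /eqP <-]].
  have := mem_nth [::] rT; have [] := triples_spec (mem_nth [::] rT).
  by case: (nth [::] T r) => [|? [|? [|? []]]].
exists (index [:: a; b; c] T); last by rewrite !itemE // index_mem abc nth_index // !eqxx.
have : index [:: a; b; c] T < size T by rewrite index_mem.
by rewrite mem_iota size_cat /= (size_flatten_const T3); lia.
Qed.

Lemma sumn_flatten_le k (ss : seq (seq nat)) :
  (forall t, t \in ss -> sumn t <= k) -> sumn (flatten ss) <= size ss * k.
Proof.
elim: ss => //= s ss IH H; rewrite sumn_cat mulSn leq_add // ?H ?mem_head // IH // => t tss.
by rewrite H // inE tss orbT.
Qed.

Lemma main_complete x : ~ arrival_lang x ->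
  exists2 u, size u <= 300 * size x ^ 4 + 300 & sat (input_word x u) (fun=> 0) FMain.
Proof.
move=> nx; case: (boolP (is_instance x)) => [/is_instanceP[n [s0 [s1 [o [d xE]]]]]|ninst]; last first.
  (* Without an instance no assignment satisfies [FValid], so the empty certificate works. *)
  exists [::] => //; apply: sat_main_intro => [e e0 eN valid|]; last by rewrite size_cat addnS.
  by rewrite (valid_is_instance e0 eN valid) in ninst.
have [|R cert Rb] := @bincert_complete n s0 s1 o d.
  by move=> term; apply: nx; exists n, s0, s1, o, d.
pose U := flatten (triples n R).
(* The unterminated run of 1s lengthens the word without adding a number to its list. *)
pose u := enc_seq U ++ nseq (8 * n + 8) true.
have xn : n < size x by rewrite xE enc_instanceE size_enc_seq size_instance_list /=; lia.
exists u.
  have Usum : sumn U <= size (triples n R) * (5 * n + 1) by apply: sumn_flatten_le => t /triples_spec[].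
  have Usz : size U = 3 * size (triples n R).
    by apply: size_flatten_const; apply/allP => t /triples_spec[/eqP].
  rewrite size_cat size_nseq size_enc_seq Usz.
  have := size_triples n R; move: (size _) (sumn U) Usum => s t ts.
  move: (size x) xn => m nm sle.
  (* Cubically many triples, each with at most [5 * n + 1] ones and three terminators, give the
     exponent 4; the constant 300 is generous. *)
  have {}sle : s <= m * m * (3 * m) by apply: leq_trans sle _; rewrite !leq_mul //; lia.
  have st : s * (5 * n + 4) <= m * m * (3 * m) * (5 * m) by rewrite leq_mul //; lia.
  have m4 : m <= m ^ 4 by rewrite -{1}(expn1 m) leq_pexp2l //; lia.
  by rewrite (_ : m * m * (3 * m) * (5 * m) = 15 * m ^ 4) in st; [lia | rewrite !expnS; lia].
pose w := input_word x u.
have usz : 8 * n + 8 <= size u by rewrite size_cat size_nseq leq_addl.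
have wN : 8 * n + 8 < size w by rewrite /w size_cat /= !size_map; lia.
have wL : items 0 w = instance_list s0 s1 o d ++ 0 :: U.
  have nil k : forall acc, items acc (map Some (nseq k true)) = [::].
    by elim: k => //= k IH acc; rewrite IH.
  by rewrite /w xE items_instance /u map_cat items_enc_seq nil cats0.
apply: sat_main_intro => [e e0 eN valid|]; last exact: leq_ltn_trans wN.
have := valid; rewrite sat_valid //; last exact: leq_ltn_trans wN.
rewrite has_separator {1}xE enc_instanceE -[X in items 0 X](cats0 (map Some _)) items_enc_seq cats0 size_instance_list.
(* Validity determines all seven variables, so the certificate has to work for one assignment
   only. *)
move=> /and5P[/eqP e1 /eqP/esym e2 /and4P[_ /eqP e5 /eqP e4 _] /and4P[_ n0 id io] _].
have itemE k : k < n.*2 + 3 -> forall a, item (items 0 (input_word x u)) k a = (nth 0 (instance_list s0 s1 o d) k == a).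
  by move=> kq a; rewrite xE item_instance.
move: n0; rewrite itemE; last by lia.
move=> /eqP/esym e3; rewrite e3 /= in e5 id io.
have {}e5 : e 5 = n.*2 + 1 by lia.
have {}e4 : e 4 = n.*2 + 2 by lia.
move: id io; rewrite e4 e5 !itemE; [|lia|lia]; rewrite nth_instance_o nth_instance_d.
move=> /eqP/esym e6 /eqP/esym e7.
rewrite xE; apply: (certificate_complete (R' := R) e0 e1 e2 e3 e6 e7); rewrite -xE -/w.
- by move=> a b c; rewrite wL -(size_instance_list s0 s1 o d) rel_of_triples.
- by apply: cert; lia.
- move=> v b; rewrite /carry_of -(@count_range (size w) (3 * n + 1)); last by lia.
  by apply: sub_count => c /andP[-> /Rb[_ _ ->]].
- exact: wN.
Qed.

Theorem theorem3 : in_coNP arrival_lang.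
Proof. exact: in_NP_formula scoped_main main_sound main_complete. Qed.
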